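(* For all $s,t\in\{1,2,3,\dots\}\cup\{\infty\}$, the set $U(s,t)$ of minimal unsortable permutations is finite. Equivalently, there is a finite set $U$ of permutations such that a permutation $\pi$ is in $\mathcal F(s,t)$ if and only if no element of $U$ is involved in $\pi$.
   Context: Forkstack sorting with capacities $s,t\in\{1,2,3,\dots\}\cup\{\infty\}$: a permutation $\pi=\pi_1\cdots\pi_n$ of $\{1,\dots,n\}$ is placed on an input stack with $\pi_1$ on top; a working stack and an output stack are initially empty. A move either (i) removes the top $k$ elements of the input stack ($1\le k\le s$) and places them as a block, relative order unchanged, on top of the working stack, or (ii) removes the top $l$ elements of the working stack ($1\le l\le t$) and places them as a block, relative order unchanged, on top of the output stack. $\pi$ is sortable if some sequence of moves ends with input and working stacks empty and the output stack reading $1,2,\dots,n$ from top to bottom. $\mathcal F(s,t)$ is the set of all sortable permutations (of all lengths). A permutation $\sigma$ is involved in $\pi$ if $\pi$ has a subsequence of the same length as $\sigma$ whose entries are in the same relative order as the entries of $\sigma$. $\mathcal F(s,t)$ is closed downward under involvement; $U(s,t)$ is the set of permutations not in $\mathcal F(s,t)$ that are minimal with respect to involvement among permutations not in $\mathcal F(s,t)$. *)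

(* Defs.v *)
From mathcomp Require Import all_boot.
Set Implicit Arguments. Unset Strict Implicit. Unset Printing Implicit Defensive.

(* Capacities in {1,2,3,...} ∪ {∞}: [Some m] is the finite capacity m,
   [None] is ∞.  Validity (m >= 1) is imposed as a hypothesis. *)
Definition capacity := option nat.
Definition cap_valid (c : capacity) : bool :=
  if c is Some m then 0 < m else true.
Definition cap_ok (c : capacity) (k : nat) : bool :=
  if c is Some m then k <= m else true.

Definition is_perm (p : seq nat) : bool := perm_eq p (iota 1 (size p)).

(* Stacks are lists whose head is the top element.
   A state is (input, working, output). *)
Definition fstate := (seq nat * seq nat * seq nat)%type.

Inductive fs_step (s t : capacity) : fstate -> fstate -> Prop :=
| fs_push (inp w out : seq nat) (k : nat) :
    0 < k -> k <= size inp -> cap_ok s k ->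
    fs_step s t (inp, w, out) (drop k inp, take k inp ++ w, out)
| fs_pop (inp w out : seq nat) (l : nat) :
    0 < l -> l <= size w -> cap_ok t l ->
    fs_step s t (inp, w, out) (inp, drop l w, take l w ++ out).

Inductive fs_reach (s t : capacity) : fstate -> fstate -> Prop :=
| fs_refl x : fs_reach s t x x
| fs_trans x y z : fs_step s t x y -> fs_reach s t y z -> fs_reach s t x z.

Definition sortable (s t : capacity) (pi : seq nat) : Prop :=
  fs_reach s t (pi, [::], [::]) ([::], [::], iota 1 (size pi)).

Definition inF (s t : capacity) (pi : seq nat) : Prop :=
  is_perm pi /\ sortable s t pi.

Definition order_iso (a b : seq nat) : Prop :=
  size a = size b /\
  forall i j, i < size a -> j < size a ->
    (nth 0 a i < nth 0 a j) = (nth 0 b i < nth 0 b j).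

Definition involved (sigma pi : seq nat) : Prop :=
  exists tau, subseq tau pi /\ order_iso sigma tau.

Definition inU (s t : capacity) (sigma : seq nat) : Prop :=
  is_perm sigma /\ ~ sortable s t sigma /\
  forall tau, is_perm tau -> involved tau sigma -> tau <> sigma ->
    sortable s t tau.

(* Main.v *)
Require Import Defs.
From mathcomp Require Import all_boot.
From mathcomp Require Import zify.
Set Implicit Arguments. Unset Strict Implicit. Unset Printing Implicit Defensive.

(** A permutation is viewed as a set of points (position, value).  A sorting run
    amounts to a certificate: a partition of the positions into push blocks (of
    size at most s) and of the values into pop blocks (of size at most t) such
    that the two points of an increasing pair share a push block iff they share a
    pop block, while for an inversion having a point above and to the right of
    it exactly one of the two holds.  Certificates restrict to subsets of
    points, so it is enough to show that a point set has a certificate as soon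
    as all its subsets of bounded size have one.

    Increasing pairs whose bounding strips contain a third point outside the
    bounding rectangle are cut in both partitions.  These forced cuts yield the
    coarsest conceivable partitions [near p] and [near q].  An inversion lying
    in only one class of the two has no freedom left; an inversion lying in
    both belongs to an interval of the permutation that is a skew sum of
    increasing runs.  The demands of the outside world on such an interval are
    to be entirely in one push block or entirely in one pop block, and distinct
    intervals do not interact.  Hence every obstruction is visible on a bounded
    number of points: the elements of one interval, or one more than s or t
    elements of a forced block, with boundedly many witnesses for each pair. *)

(** * Point sets and certificates *)

Section Points.
Variables (T : finType) (p q : T -> nat).

Definition asc i j := (p i < p j) && (q i < q j).
Definition agree i j := (p i < p j) == (q i < q j).
Definition top i := [forall k, ~~ asc i k].
Definition linked i j := [exists k, asc i k && asc j k].
Definition between (f : T -> nat) i r j := f i < f r < f j.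
Definition split_by i j r := between p i r j != between q i r j.
(* In every certificate, the two points of a pair with a splitting point lie in
   different classes of both relations; for pairs [asc i j] with [top j] this
   can be assumed without loss of generality. *)
Definition bad i j := asc i j && (top j || [exists r, split_by i j r]).
Definition hull (f : T -> nat) i j x :=
  (f i <= f x <= f j) || (f j <= f x <= f i).
(* [near p] (resp. [near q]) is the coarsest relation that the push blocks
   (resp. the pop blocks) may form. *)
Definition near f i j :=
  [forall u, forall w, bad u w ==> ~~ (hull f i j u && hull f i j w)].

(** Equivalence relations on [W] whose classes are intervals in the order of [f]. Only the lower
    half of convexity is demanded; symmetry and transitivity give the other half. *)
Definition conv_equiv (f : T -> nat) (W : {set T}) (r : rel T) : Prop :=
  [/\ {in W, forall x, r x x},
      {in W &, forall x y, r x y -> r y x},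
      {in W & &, forall x y z, r x y -> r y z -> r x z} &
      {in W & &, forall x y z, f x < f y -> f y < f z -> r x z -> r x y}].

Definition classes_le (c : capacity) (W : {set T}) (r : rel T) : Prop :=
  {in W, forall x, cap_ok c #|[set y in W | r x y]|}.

(* [b] and [g] stand for "pushed in the same block" and "popped in the same
   block".  The last clause says that if [j] is to land on top of a larger [i]
   without joining its block, then [i], hence everything that leaves with it
   or before it, must have been pushed before the block of [j]. *)
Definition compatible (W : {set T}) (b g : rel T) : Prop :=
  {in W &, forall i j, p i < p j ->
    if q i < q j then b i j = g i j
    else ~~ (b i j && g i j) /\
      (~~ b i j -> ~~ g i j -> {in W, forall k,
         ~~ (((p j < p k) || b j k) && ((q i < q k) || g i k))})}.

Definition certificate s t W b g : Prop :=
  [/\ conv_equiv p W b, conv_equiv q W g, classes_le s W b,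
      classes_le t W g & compatible W b g].

End Points.

(** * Symmetry between positions and values *)

Section Swap.
Variables (T : finType) (p q : T -> nat).

Lemma ascC : asc q p =2 asc p q.
Proof. by move=> i j; rewrite /asc andbC. Qed.

Lemma agreeC : agree q p =2 agree p q.
Proof. by move=> i j; rewrite /agree eq_sym. Qed.

Lemma topC : top q p =1 top p q.
Proof. by move=> i; apply: eq_forallb => k; rewrite ascC. Qed.

Lemma linkedC : linked q p =2 linked p q.
Proof. by move=> i j; apply: eq_existsb => k; rewrite !ascC. Qed.

Lemma badC : bad q p =2 bad p q.
Proof.
move=> i j; rewrite /bad ascC topC; congr (_ && (_ || _)).
by apply: eq_existsb => r; rewrite /split_by eq_sym.
Qed.

Lemma nearC f : near q p f =2 near p q f.
Proof.
by move=> i j; apply: eq_forallb => u; apply: eq_forallb => w; rewrite badC.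
Qed.

(** Exchanging positions with values and pushes with pops reverses the roles of the two points of an
    inversion, and the two factors of the last clause trade places accordingly. Each later result on
    pushes thus has a mirror image on pops. *)
Lemma compatible_swap W b g : injective p -> injective q ->
  compatible p q W b g -> conv_equiv p W b -> conv_equiv q W g ->
  compatible q p W g b.
Proof.
move=> injp injq C [_ sb _ _] [_ sg _ _] i j Wi Wj lt_q.
have [lt_p|lt_p|/injp eq_ij] := ltngtP (p i) (p j); last by move: lt_q; rewrite eq_ij ltnn.
  by have := C i j Wi Wj lt_p; rewrite lt_q => ->.
have := C j i Wj Wi lt_p; rewrite ltnNge (ltnW lt_q) /= => -[nb H].
have eb : b i j = b j i by apply/idP/idP; exact: sb.
have eg : g i j = g j i by apply/idP/idP; exact: sg.
rewrite eb eg andbC; split=> // ng nb' k Wk.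
by rewrite andbC; exact: H.
Qed.

Lemma certificate_swap s t W b g : injective p -> injective q ->
  certificate p q s t W b g -> certificate q p t s W g b.
Proof.
by move=> injp injq [Cp Cq Ss St C]; split => //; apply: compatible_swap.
Qed.

End Swap.

(** * Forced cuts and the relations [near] *)

Section Core.
Variables (T : finType) (p q : T -> nat).
Hypotheses (injp : injective p) (injq : injective q).

Local Notation asc := (asc p q).
Local Notation agree := (agree p q).
Local Notation top := (top p q).
Local Notation linked := (linked p q).
Local Notation bad := (bad p q).
Local Notation near := (near p q).
Local Notation split_by := (split_by p q).

Lemma neq_coord i j : i <> j -> p i <> p j /\ q i <> q j.
Proof. by move=> ne; split=> [/injp|/injq]. Qed.

Lemma ascE i j : asc i j = (p i < p j) && (q i < q j).
Proof. by []. Qed.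

Lemma agreeE i j : agree i j = ((p i < p j) == (q i < q j)).
Proof. by []. Qed.

Lemma agree_sym i j : agree i j = agree j i.
Proof.
have [->//|/eqP/neq_coord[]] := eqVneq i j.
by rewrite !agreeE; lia.
Qed.

Lemma agreeP i j : agree i j -> [\/ i = j, asc i j | asc j i].
Proof.
have [->|/eqP/neq_coord[np nq]] := eqVneq i j; first by constructor 1.
rewrite agreeE !ascE => ag.
have [lt|ge] := ltnP (p i) (p j); [constructor 2|constructor 3]; lia.
Qed.

Lemma topP i j : top i -> asc i j -> False.
Proof. by move=> /forallP/(_ j)/negP. Qed.

Lemma asc_ntop i j : asc i j -> ~~ top i.
Proof. by move=> ij; apply/negP => /topP; apply; exact: ij. Qed.

Lemma exists_top i : ~~ top i -> exists2 m, top m & asc i m.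
Proof.
rewrite negb_forall => /existsP[k0 /negPn k0P].
case: (arg_maxnP p k0P) => m im mmax; exists m => //.
apply/forallP => k; apply/negP => mk.
have: asc i k by move: im mk; rewrite !ascE; lia.
by move/mmax => /=; move: mk; rewrite !ascE; lia.
Qed.

Lemma linked_sym i j : linked i j = linked j i.
Proof. by apply: eq_existsb => k; rewrite andbC. Qed.

Lemma linked_agree i j : ~~ top i -> ~~ top j -> agree i j -> linked i j.
Proof.
wlog ij : i j / i = j \/ asc i j => [W ti tj ag|].
  case: (agreeP ag) => ij; [apply: W|apply: W|rewrite linked_sym; apply: W]; auto.
  by rewrite agree_sym.
move=> _ /exists_top[m _ jm] _; apply/existsP; exists m; rewrite jm andbT.
by case: ij => [->//|ij]; move: ij jm; rewrite !ascE; lia.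
Qed.

Lemma bad_top u w : asc u w -> top w -> bad u w.
Proof. by move=> uw tw; apply/andP; rewrite tw. Qed.

Lemma bad_split_by u w r : asc u w -> split_by u w r -> bad u w.
Proof.
by move=> uw sr; apply/andP; split=> //; apply/orP; right; apply/existsP; exists r.
Qed.

Lemma badP u w : bad u w -> asc u w /\ (top w \/ exists r, split_by u w r).
Proof. by case/andP=> uw /orP[|/existsP]; split; auto. Qed.

Lemma split_byE u w r :
  split_by u w r = ((p u < p r < p w) != (q u < q r < q w)).
Proof. by []. Qed.

(** Forced cuts can be localised, which makes [near p] transitive. If [j] lies outside the rectangle
    of [u] and [w], one of these two splits [j] from the other. If it lies inside, either [w] is top
    and so bad for [j] too, or the splitting point of the pair splits one of the halves. *)
Lemma bad_split u w j : bad u w -> p u < p j < p w -> bad u j \/ bad j w.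
Proof.
move=> /badP[uw bw] jP.
have nju : j <> u by move=> e; move: jP; rewrite e; lia.
have njw : j <> w by move=> e; move: jP; rewrite e; lia.
have [pju qju] := neq_coord nju; have [pjw qjw] := neq_coord njw.
have [lt_jw|ge_jw] := ltnP (q j) (q w); last first.
  by left; apply: (@bad_split_by _ _ w); move: uw; rewrite ?ascE ?split_byE; lia.
case: bw => [tw|[r sr]].
  by right; apply: bad_top => //; rewrite ascE; lia.
have [lt_uj|ge_uj] := ltnP (q u) (q j); last first.
  by right; apply: (@bad_split_by _ _ u); move: uw; rewrite ?ascE ?split_byE; lia.
have nrj : r <> j by move=> e; move: sr; rewrite e split_byE; lia.
have [prj qrj] := neq_coord nrj.
have [rj|rj] := boolP (split_by u j r).
  by left; apply: bad_split_by rj; rewrite ascE; lia.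
right; apply: (@bad_split_by _ _ r); first by rewrite ascE; lia.
by move: sr rj; rewrite !split_byE; lia.
Qed.

Lemma nearP (f : T -> nat) i j :
  reflect (forall u w, bad u w -> hull f i j u -> hull f i j w -> False)
          (near f i j).
Proof.
apply: (iffP forallP) => [H u w B hu hw|H u].
  by have /forallP/(_ w)/implyP/(_ B) := H u; rewrite hu hw.
by apply/forallP => w; apply/implyP => B; apply/negP => /andP[hu hw]; exact: H B hu hw.
Qed.

Lemma nearPn (f : T -> nat) i j : ~~ near f i j ->
  exists u w, [/\ bad u w, hull f i j u & hull f i j w].
Proof.
rewrite negb_forall => /existsP[u]; rewrite negb_forall => /existsP[w].
by rewrite negb_imply negbK => /and3P[*]; exists u, w.
Qed.

Lemma hullE (f : T -> nat) i j x :
  hull f i j x = (f i <= f x <= f j) || (f j <= f x <= f i).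
Proof. by []. Qed.

Lemma near_sym (f : T -> nat) i j : near f i j = near f j i.
Proof.
by apply: eq_forallb => u; apply: eq_forallb => w; rewrite /hull orbC [in X in _ && X]orbC.
Qed.

Lemma near_refl i : near p i i.
Proof.
by apply/nearP => u w /badP[] /[swap] _; rewrite ascE !hullE; lia.
Qed.

Lemma near_trans i j k : near p i j -> near p j k -> near p i k.
Proof.
move=> /nearP ij /nearP jk; apply/nearP => u w B.
have uw : p u < p w by case/badP: (B) => /andP[].
have [jP|nP] := boolP (p u < p j < p w).
  rewrite !hullE => hu hw.
  have [B'|B'] := bad_split B jP; have := ij _ _ B'; have := jk _ _ B';
  rewrite !hullE; lia.
by have := ij _ _ B; have := jk _ _ B; rewrite !hullE; lia.
Qed.

Lemma near_sub i j x : near p i j -> hull p i j x -> near p i x.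
Proof.
move=> /nearP ij hx; apply/nearP => u w B hu hw; apply: (ij _ _ B);
by move: hx hu hw; rewrite !hullE; lia.
Qed.

(** A point in the value strip of an increasing pair but outside its position strip would split the
    pair and make it bad. So the value hull lies inside the position hull, which contains no bad
    pair. *)
Lemma near_agree i j : agree i j -> near p i j -> near q i j.
Proof.
wlog ij : i j / i = j \/ asc i j => [W ag|].
  case: (agreeP ag) => ij; [apply: W|apply: W|]; auto.
  by rewrite !(near_sym _ i); apply: W; auto; rewrite agree_sym.
case: ij => [<- _ _|ij _ /nearP N].
  by apply/nearP => u w /badP[] /[swap] _; rewrite ascE !hullE; lia.
have in_p x : hull q i j x -> hull p i j x.
  have [->|/eqP/neq_coord[? ?]] := eqVneq x i; first by move: ij; rewrite ascE !hullE; lia.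
  have [->|/eqP/neq_coord[? ?]] := eqVneq x j; first by move: ij; rewrite ascE !hullE; lia.
  move=> hx; have [|sx] := boolP (split_by i j x).
    move=> /(bad_split_by ij) B; case: (N _ _ B); move: ij; rewrite ascE !hullE; lia.
  by move: ij hx sx; rewrite ascE split_byE !hullE; lia.
by apply/nearP => u w B /in_p hu /in_p hw; exact: N B hu hw.
Qed.

(** The staircase avoids push classes. A top point [k] above [i] must lie beyond [j], since it forms
    a bad pair with [i]; then [m] either is above [i], a bad pair again, or lies below [k] and is
    not top. *)
Lemma top_between i j m : ~~ top i -> top m -> p i < p m -> p m <= p j ->
  near p i j -> False.
Proof.
move=> /exists_top[k tk ik] tm im mj /nearP N.
have [kj|kj] := leqP (p k) (p j).
  by apply: (N _ _ (bad_top ik tk)); move: ik; rewrite ascE !hullE; lia.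
have nmi : m <> i by move=> e; move: im; rewrite e; lia.
have [_ nq] := neq_coord nmi.
have [lt|ge] := ltnP (q i) (q m).
  have im' : asc i m by rewrite ascE im.
  by apply: (N _ _ (bad_top im' tm)); rewrite !hullE; lia.
by apply: (topP (j := k) tm); move: ik; rewrite !ascE; lia.
Qed.

(** By [top_between], a top point above the left point lies to the right of both; if the pair is an
    inversion it is also higher than the right point. *)
Lemma near_linked i j : ~~ top i -> ~~ top j -> near p i j -> linked i j.
Proof.
wlog ij : i j / p i < p j => [W ti tj N|ti tj N].
  have [->|/eqP/neq_coord[np _]] := eqVneq i j.
    by apply: linked_agree => //; rewrite agreeE !ltnn.
  have [lt|ge] := ltnP (p i) (p j); first exact: W.
  by rewrite linked_sym; apply: W => //; [lia|rewrite near_sym].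
have [m tm im] := exists_top ti.
have [mj|mj] := leqP (p m) (p j).
  by case: (@top_between i j m) => //; move: im; rewrite ascE; lia.
have nij : i <> j by move=> e; move: ij; rewrite e; lia.
have [_ nq] := neq_coord nij.
have [lt|ge] := ltnP (q i) (q j); first by apply: linked_agree => //; rewrite agreeE ij lt.
apply/existsP; exists m; rewrite im; move: im; rewrite !ascE; lia.
Qed.

(* A bad pair due to a point of the staircase [top] can be replaced, below a
   common upper bound, by one that comes from a splitting point. *)
Lemma split_of_not_near i j : linked i j -> p i < p j -> ~~ near p i j ->
  exists u w r, [/\ asc u w, split_by u w r, p i <= p u & p w <= p j].
Proof.
move=> /existsP[k /andP[ik jk]] ij /nearPn[u [w [/badP[uw bw] hu hw]]].
move: hu hw; rewrite !hullE => hu hw.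
case: bw => [tw|[r sr]]; last by exists u, w, r; split=> //; lia.
have nwj : w <> j by move=> e; case: (topP tw (j := k)); rewrite e.
have nwk : w <> k by move=> e; move: jk hw; rewrite e ascE; lia.
have [? ?] := neq_coord nwj; have [? ?] := neq_coord nwk.
have qkw : q k < q w.
  have [//|lt] := ltnP (q k) (q w); case: (topP tw (j := k)).
  by move: jk; rewrite !ascE; lia.
exists i, w, k; move: ik jk uw; rewrite !split_byE !ascE => *; split; lia.
Qed.

Lemma asc_agree u w : asc u w -> agree u w.
Proof. by rewrite ascE agreeE => /andP[-> ->]. Qed.

(** A point in the position strip but off the rectangle lies above or below it, so it forms an
    inversion with exactly one of the two corners. *)
Lemma split_cases u w r : asc u w -> between p u r w -> ~~ between q u r w ->
  agree r w /\ ~~ agree u r \/ agree u r /\ ~~ agree r w.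
Proof.
rewrite /between ascE => uw pr nq.
have nru : r <> u by move=> e; rewrite e ltnn in pr.
have nrw : r <> w by move=> e; rewrite e ltnn andbF in pr.
have [? ?] := neq_coord nru; have [? ?] := neq_coord nrw.
by have [lt|ge] := ltnP (q r) (q u); [left|right]; rewrite !agreeE; split; lia.
Qed.

(** * What a certificate forces *)

Section Certificates.
Variables (s t : capacity) (W : {set T}) (b g : rel T).
Hypothesis cert : certificate p q s t W b g.

Lemma cert_agree i j : i \in W -> j \in W -> agree i j -> b i j = g i j.
Proof.
have [[rb sb _ _] [rg sg _ _] _ _ C] := cert.
move=> Wi Wj /agreeP[<-|/andP[ij lt]|/andP[ij lt]]; first by rewrite rb ?rg.
  by have := C i j Wi Wj ij; rewrite lt.
have := C j i Wj Wi ij; rewrite lt => e.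
by apply/idP/idP => [/(sb _ _ Wi Wj)|/(sg _ _ Wi Wj)]; rewrite (e, =^~ e); [move/sg|move/sb]; exact.
Qed.

Lemma cert_inversion i j : i \in W -> j \in W -> ~~ agree i j -> ~~ (b i j && g i j).
Proof.
have [[rb sb _ _] [rg sg _ _] _ _ C] := cert.
move=> Wi Wj ag; have nij : i <> j by move=> e; move: ag; rewrite e agreeE !ltnn.
have [? ?] := neq_coord nij; have [ij|ij] := ltnP (p i) (p j).
  have := C i j Wi Wj ij; have -> : q i < q j = false by move: ag; rewrite agreeE; lia.
  by case.
have ji : p j < p i by lia.
have := C j i Wj Wi ji; have -> : q j < q i = false by move: ag; rewrite agreeE; lia.
by case=> /negP nbg _; apply/negP => /andP[/sb bb /sg gg]; apply: nbg; rewrite bb ?gg.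
Qed.

(** The common upper bound [k] activates the last clause of [compatible]: the points of an inversion
    share at least one block, hence exactly one. *)
Lemma cert_xor i j k : i \in W -> j \in W -> k \in W -> asc i k -> asc j k ->
  b i j (+) g i j = ~~ agree i j.
Proof.
have [[rb sb _ _] [rg sg _ _] _ _ C] := cert.
move=> Wi Wj Wk ik jk; have [ag|ag] /= := boolP (agree i j).
  by rewrite (cert_agree Wi Wj ag) addbb.
have := cert_inversion Wi Wj ag.
suff: b i j || g i j by case: (b i j); case: (g i j).
have nij : i <> j by move=> e; move: ag; rewrite e agreeE !ltnn.
have [? ?] := neq_coord nij; have [ij|ij] := ltnP (p i) (p j).
  have := C i j Wi Wj ij; have -> : q i < q j = false by move: ag; rewrite agreeE; lia.
  case=> _ H; case: (boolP (b i j)) => //= nb; case: (boolP (g i j)) => //= ng.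
  by have := H nb ng k Wk; move: ik jk; rewrite !ascE => /andP[_ ->] /andP[-> _].
have ji : p j < p i by lia.
have := C j i Wj Wi ji; have -> : q j < q i = false by move: ag; rewrite agreeE; lia.
case=> _ H; apply: contraT; rewrite negb_or => /andP[nb ng].
have nb' : ~~ b j i by apply: contra nb; exact: sb.
have ng' : ~~ g j i by apply: contra ng; exact: sg.
by have := H nb' ng' k Wk; move: ik jk; rewrite !ascE => /andP[-> _] /andP[_ ->].
Qed.

Lemma conv_trans i j k : i \in W -> j \in W -> k \in W ->
  p i < p j -> p j < p k -> b i k -> b i j /\ b j k.
Proof.
have [[rb sb tb cb] _ _ _ _] := cert => Wi Wj Wk ij jk ik.
have bij := cb _ _ _ Wi Wj Wk ij jk ik; split=> //.
by apply: (tb j i k) => //; exact: sb.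
Qed.

(** If [u] and [w] shared a push block, so would [r] by convexity, and [u], [w] would share a pop
    block as well. The corner agreeing with [r] pulls [r] into that pop block, so the other corner
    and [r] form an inversion sharing both blocks. *)
Lemma cert_split_p u w r : u \in W -> w \in W -> r \in W ->
  asc u w -> between p u r w -> ~~ between q u r w -> ~~ b u w.
Proof.
have [[rb sb tb cb] [rg sg tg cg] _ _ _] := cert.
move=> Wu Ww Wr uw pr nq; apply/negP => buw.
have guw : g u w by rewrite -cert_agree ?asc_agree.
have [ur rw] := andP pr.
have [bur brw] := conv_trans Wu Wr Ww ur rw buw.
have [[ag nag]|[ag nag]] := split_cases uw pr nq.
  have grw : g r w by rewrite -cert_agree.
  by have := cert_inversion Wu Wr nag; rewrite bur (tg u w r) //; exact: sg.
have gur : g u r by rewrite -cert_agree.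
by have := cert_inversion Wr Ww nag; rewrite brw (tg r u w) //; exact: sg.
Qed.

End Certificates.

End Core.

(** * Bounded witnesses *)

Lemma cap_ok_leq c m n : m <= n -> cap_ok c n -> cap_ok c m.
Proof. by case: c => //= k; exact: leq_trans. Qed.

Section Restriction.
Variables (T : finType) (A W : {set T}).
Hypothesis sAW : A \subset W.

Lemma conv_equiv_sub f r : conv_equiv f W r -> conv_equiv f A r.
Proof.
move/subsetP: sAW => sub [rr sr tr cr]; split.
- by move=> x /sub; exact: rr.
- by move=> x y /sub Wx /sub Wy; exact: sr.
- by move=> x y z /sub Wx /sub Wy /sub Wz; exact: tr.
- by move=> x y z /sub Wx /sub Wy /sub Wz; exact: cr.
Qed.

Lemma classes_le_sub c r : classes_le c W r -> classes_le c A r.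
Proof.
move/subsetP: sAW => sub le x Ax; apply: cap_ok_leq (le x (sub x Ax)).
by apply: subset_leq_card; apply/subsetP => y; rewrite !inE => /andP[/sub-> ->].
Qed.

End Restriction.

Section Witnesses.
Variables (T : finType).

Lemma cert_split (p q : T -> nat) s t W b g u w r :
  injective p -> injective q -> certificate p q s t W b g ->
  u \in W -> w \in W -> r \in W -> asc p q u w -> split_by p q u w r -> ~~ b u w.
Proof.
move=> injp injq cert Wu Ww Wr uw; rewrite /split_by.
case: (boolP (between p u r w)) => pr.
  by rewrite eq_sym eqb_id => nq; exact: (cert_split_p injp injq cert Wu Ww Wr uw pr).
case: (boolP (between q u r w)) => // qr _.
have -> : b u w = g u w by apply: (cert_agree injp injq cert); rewrite ?asc_agree.
apply: (cert_split_p injq injp (certificate_swap injp injq cert)) qr pr => //.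
by rewrite ascC.
Qed.

(** The witnesses are a pair between [i] and [j] and a point splitting it; by convexity a cut
    between the pair separates [i] from [j]. They are chosen before the certificate, hence depend on
    [i] and [j] only. *)
Lemma not_near_witness (p q : T -> nat) i j : injective p -> injective q -> 
  linked p q i j ->
  exists2 S : {set T}, #|S| <= 3 & forall s t W b g, certificate p q s t W b g ->
    S \subset W -> i \in W -> j \in W -> ~~ near p q p i j -> ~~ b i j.
Proof.
move=> injp injq lij.
have [nr|nr] := boolP (near p q p i j); first by exists set0; rewrite ?cards0.
wlog ij : i j lij nr / p i < p j => [Wl|].
  have [e|/eqP/(neq_coord injp injq)[np _]] := eqVneq i j; first by rewrite e near_refl in nr.
  have [lt|ge] := ltnP (p i) (p j); first exact: Wl.
  have lji : linked p q j i by rewrite linked_sym.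
  have nji : ~~ near p q p j i by rewrite near_sym.
  have [|S cS HS] := Wl j i lji nji; first by clear -np ge; lia.
  exists S => // s t W b g cert sS Wi Wj nr'; have [[_ sb _ _] _ _ _ _] := cert.
  by apply: contra (HS _ _ _ _ _ cert sS Wj Wi isT); exact: sb.
have [u [w [r [uw sr iu wj]]]] := split_of_not_near injp injq lij ij nr.
exists [set u; w; r] => [|s t W b g cert /subsetP sS Wi Wj _].
  by rewrite -setUA (leq_trans (leq_card_setU _ _)) // cards1 cards2; case: (_ != _).
have Wu : u \in W by apply: sS; rewrite !inE eqxx.
have Ww : w \in W by apply: sS; rewrite !inE eqxx orbT.
have Wr : r \in W by apply: sS; rewrite !inE eqxx !orbT.
have [[rb sb tb cb] _ _ _ _] := cert.
apply: contra (cert_split injp injq cert Wu Ww Wr uw sr) => bij.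
have lt_uw : p u < p w by case/andP: uw.
have biw : b i w.
  have [->//|/eqP/(neq_coord injp injq)[nwj _]] := eqVneq w j.
  by apply: (cb i w j) => //; clear -iu wj lt_uw nwj; lia.
have [->//|/eqP/(neq_coord injp injq)[nui _]] := eqVneq u i.
apply: (tb u i w) => //; apply: sb => //; apply: (cb i u w) => //; clear -iu wj lt_uw nui; lia.
Qed.

Variables (p q : T -> nat).
Hypotheses (injp : injective p) (injq : injective q).

(** The constraints on a pair after third points have been eliminated: [agree] and [near] are
    computed in the whole point set, so these rules can be imposed on a subset. *)
Definition local_rules (b g : rel T) i j :=
  [/\ b i j (+) g i j = ~~ agree p q i j,
      ~~ near p q p i j -> ~~ b i j & ~~ near p q q i j -> ~~ g i j].

Definition local_certificate s t A b g :=
  [/\ conv_equiv p A b, conv_equiv q A g, classes_le s A b, classes_le t A g &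
      {in A &, forall i j, linked p q i j -> local_rules b g i j}].

Lemma pair_witness i j : linked p q i j ->
  exists2 S : {set T}, #|S| <= 7 & forall s t W b g, certificate p q s t W b g ->
    S \subset W -> i \in W -> j \in W -> local_rules b g i j.
Proof.
move=> lij; have [S1 c1 H1] := not_near_witness injp injq lij.
have := lij; rewrite -linkedC => lij'; have [S2 c2 H2] := not_near_witness injq injp lij'.
have /existsP[k /andP[ik jk]] := lij.
(* 7 = 1 + 3 + 3: [k] for the exclusive or, and three witnesses for each of the two possible
   cuts. *)
exists (k |: S1 :|: S2) => [|s t W b g cert sS Wi Wj].
  apply: leq_trans (leq_card_setU _ _) _; apply: (@leq_add _ _ 4 3) => //.
  by apply: leq_trans (leq_card_setU _ _) _; rewrite cards1 add1n.
move: sS; rewrite !subUset sub1set => /andP[/andP[Wk s1] s2]; split.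
- exact: (cert_xor injp injq cert Wi Wj Wk).
- exact: H1 cert s1 Wi Wj.
- by move=> nr; apply: (H2 _ _ _ _ _ (certificate_swap injp injq cert)) => //; rewrite nearC.
Qed.

(** Add to [A] the at most 7 witnesses of each of its ordered pairs, and restrict a certificate of
    the enlarged set. *)
Lemma local_certificate_of s t N :
  (forall W : {set T}, #|W| <= N -> exists b g, certificate p q s t W b g) ->
  forall A : {set T}, #|A| + 7 * #|A| ^ 2 <= N -> exists b g, local_certificate s t A b g.
Proof.
move=> H A cA.
have /fin_all_exists[S HS] : forall x : T * T, exists S : {set T}, #|S| <= 7 /\
    (linked p q x.1 x.2 -> forall s t W b g, certificate p q s t W b g ->
    S \subset W -> x.1 \in W -> x.2 \in W -> local_rules b g x.1 x.2).
  move=> [i j] /=; have [/pair_witness[S cS HS]|nl] := boolP (linked p q i j).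
    by exists S; split.
  by exists set0; rewrite cards0.
pose W := A :|: \bigcup_(x in setX A A) S x.
have [|b [g cert]] := H W.
  apply: leq_trans cA; apply: leq_trans (leq_card_setU _ _) _; rewrite leq_add2l.
  have -> : 7 * #|A| ^ 2 = \sum_(x in setX A A) 7.
    by rewrite sum_nat_const cardsX mulnC.
  elim/big_rec2: _ => [|x n B _ IH]; first by rewrite cards0.
  by apply: leq_trans (leq_card_setU _ _) _; apply: leq_add => //; case: (HS x).
have sA : A \subset W by exact: subsetUl.
have [cb cg lb lg _] := cert; exists b, g; split.
- exact: conv_equiv_sub sA _ _ cb.
- exact: conv_equiv_sub sA _ _ cg.
- exact: classes_le_sub sA _ _ lb.
- exact: classes_le_sub sA _ _ lg.
move=> i j Ai Aj lij; have [_ Hij] := HS (i, j).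
apply: Hij lij _ _ _ _ _ cert _ _ _; rewrite ?(subsetP sA) //=.
by apply: subset_trans (subsetUr _ _); apply: bigcup_sup; rewrite inE /= Ai.
Qed.

End Witnesses.

Lemma local_certificate_swap (T : finType) (p q : T -> nat) s t A b g :
  local_certificate p q s t A b g -> local_certificate q p t s A g b.
Proof.
case=> cb cg lb lg R; split=> // i j Ai Aj.
rewrite linkedC => /(R _ _ Ai Aj)[x nb ng]; split; rewrite 1?nearC //.
by rewrite addbC x agreeC.
Qed.

(** * Intervals without forced cuts *)

(** An infinite capacity is never exceeded and contributes no witnesses, whence the value 0. *)
Definition cap_size (c : capacity) : nat := if c is Some m then m else 0.

Lemma cap_okPn c n : ~~ cap_ok c n -> exists2 m, c = Some m & m < n.
Proof. by case: c => //= m; rewrite -ltnNge; exists m. Qed.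

Lemma subset_of_card (T : finType) (A : {set T}) n : n <= #|A| ->
  exists2 B : {set T}, B \subset A & #|B| = n.
Proof.
move=> /card_geqP[s [us <- sA]]; exists [set x in s]; last by rewrite cardsE; exact/card_uniqP.
by apply/subsetP => x; rewrite inE; exact: sA.
Qed.

Lemma card_setU_le (T : finType) (A B : {set T}) m n :
  #|A| <= m -> #|B| <= n -> #|A :|: B| <= m + n.
Proof. by move=> Am Bn; apply: leq_trans (leq_card_setU _ _) (leq_add Am Bn). Qed.

Section Classes.
Variables (T : finType) (p q : T -> nat).
Hypotheses (injp : injective p) (injq : injective q).

Local Notation asc := (asc p q).
Local Notation agree := (agree p q).
Local Notation top := (top p q).
Local Notation near := (near p q).
Local Notation bad := (bad p q).

(* A [kin] class is a skew sum of increasing runs, occupying an interval of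
   positions and an interval of values.  A demand on [c] forces the class of [c]
   to be pushed as part of one block. *)
Definition kin i j := near p i j && near q i j.
Definition kin_class c := [set j | ~~ top j && kin c j].
Definition demand c := [exists o, [&& ~~ top o, near p c o & ~~ near q c o]].

Lemma demandP c o : ~~ top o -> near p c o -> ~~ near q c o -> demand c.
Proof. by move=> *; apply/existsP; exists o; apply/and3P. Qed.

Lemma agree_refl i : agree i i.
Proof. by rewrite agreeE !ltnn. Qed.

Lemma near_not_bad i j : near p i j -> ~~ bad i j.
Proof.
by move=> /nearP N; apply/negP => B; apply: (N _ _ B); rewrite !hullE leqnn ?orbT ?andbT /=; 
  have [] := badP B; rewrite ascE; lia.
Qed.

(** If two points below (or above) a common point formed an inversion, one of them would split the
    other from the common point, a bad pair excluded by [near]. This decomposes a class into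
    increasing runs. *)
Lemma agree_trans i j k : near p i j -> near p j k ->
  agree i j -> agree j k -> agree i k.
Proof.
have key x y z : near p x y -> near p y z -> asc x y -> asc z y -> agree x z.
  move=> _ Nyz xy zy; apply: contraT => nag.
  have nxz : x <> z by move=> e; rewrite e agree_refl in nag.
  have [? ?] := neq_coord injp injq nxz.
  have : near p z y by rewrite near_sym.
  move/near_not_bad/negP => []; apply: (@bad_split_by _ _ _ _ _ x) => //.
  by move: xy zy nag; rewrite !ascE split_byE agreeE; lia.
have key' x y z : near p x y -> near p y z -> asc y x -> asc y z -> agree x z.
  move=> _ Nyz xy zy; apply: contraT => nag.
  have nxz : x <> z by move=> e; rewrite e agree_refl in nag.
  have [? ?] := neq_coord injp injq nxz.
  move/near_not_bad/negP: Nyz => []; apply: (@bad_split_by _ _ _ _ _ x) => //.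
  by move: xy zy nag; rewrite !ascE split_byE agreeE; lia.
move=> Nij Njk /(agreeP injp injq)[->//|ij|ji] /(agreeP injp injq)[<-|jk|kj].
- exact: asc_agree.
- by apply: asc_agree; move: ij jk; rewrite !ascE; clear; lia.
- exact: key Nij Njk ij kj.
- by rewrite agree_sym //; exact: asc_agree.
- exact: key' Nij Njk ji jk.
- by rewrite agree_sym //; apply: asc_agree; move: ji kj; rewrite !ascE; clear; lia.
Qed.

Section Demands.
Variables (s t : capacity) (A : {set T}) (b g : rel T).
Hypothesis cert : local_certificate p q s t A b g.

(** By [near_agree] the pair is an inversion; it is cut in the pop blocks, so the exclusive or
    places it in one push block. *)
Lemma demanded x y : x \in A -> y \in A -> ~~ top x -> ~~ top y ->
  near p x y -> ~~ near q x y -> b x y.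
Proof.
have [_ _ _ _ R] := cert => Ax Ay tx ty Np Nq.
have [] := R x y Ax Ay (near_linked injp injq tx ty Np).
have -> : agree x y = false by apply: contraNF Nq => ag; exact: (near_agree injp injq).
by move=> xor _ /(_ Nq) ng; move: xor; rewrite (negbTE ng) addbF.
Qed.

End Demands.

Section Trichotomy.
Variables (s t : capacity) (A : {set T}) (b g : rel T).
Hypothesis cert : local_certificate p q s t A b g.
Hypothesis kinA : {in A &, forall x y, kin x y}.
Hypothesis ntopA : {in A, forall x, ~~ top x}.

Lemma xorA x y : x \in A -> y \in A -> b x y (+) g x y = ~~ agree x y.
Proof.
have [_ _ _ _ R] := cert => Ax Ay.
have /andP[Np _] := kinA Ax Ay.
by have [] := R x y Ax Ay (near_linked injp injq (ntopA Ax) (ntopA Ay) Np).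
Qed.

Lemma agree_transA x y z : x \in A -> y \in A -> z \in A ->
  agree x y -> agree y z -> agree x z.
Proof.
move=> Ax Ay Az; apply: agree_trans; [case/andP: (kinA Ax Ay)|case/andP: (kinA Ay Az)] => //.
Qed.

(* If an increasing run is cut between [u] and [v], then every other point is
   tied to exactly one of them by each of the two relations. *)
Lemma cut_cover u v i j : u \in A -> v \in A -> i \in A -> j \in A ->
  agree u v -> ~~ b u v -> ~~ agree i j -> {in A, forall y, g u y || g v y}.
Proof.
move=> Au Av Ai Aj auv nuv nij y Ay.
have [[rb sb tb _] [rg sg tg _] _ _ _] := cert.
have nguv : ~~ g u v by have := xorA Au Av; rewrite auv; case: (b u v) nuv => //= _ ->.
(* Were [w] tied to both [u] and [v] by [g], or to both by [b], transitivity would tie [u] to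
   [v]. *)
have inv_cover w : w \in A -> ~~ agree u w -> g u w (+) g v w.
  move=> Aw nuw; have nvw : ~~ agree v w.
    by apply: contra nuw; exact: agree_transA.
  have := xorA Au Aw; have := xorA Av Aw; rewrite nuw nvw /=.
  move=> xv xu; apply: contraT ; rewrite negb_add => /eqP e.
  move: xv xu; rewrite -e; have [guw|_] := boolP (g u w); rewrite ?addbF => bvw buw.
    by case/negP: nguv; apply: (tg u w v) => //; apply: sg => //; rewrite -e.
  by case/negP: nuv; apply: (tb u w v) => //; exact: sb.
have [ay|ny] := boolP (agree u y); last first.
  by have := inv_cover y Ay ny; case: (g u y).
have [w Aw nuw] : exists2 w, w \in A & ~~ agree u w.
  have [ai|ni] := boolP (agree u i); last by exists i.
  exists j => //; apply: contra nij => aj.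
  by apply: (@agree_transA i u j) => //; rewrite agree_sym.
have nyw : ~~ agree y w by apply: contra nuw; exact: agree_transA.
have nvw : ~~ agree v w by apply: contra nuw; exact: agree_transA.
have avy : agree v y by apply: (@agree_transA v u y) => //; rewrite agree_sym.
have := xorA Ay Aw; rewrite nyw /=.
have := inv_cover w Aw nuw; have := xorA Au Aw; have := xorA Av Aw; rewrite nuw nvw /=.
have eyu := xorA Au Ay; have eyv := xorA Av Ay; rewrite ay in eyu; rewrite avy in eyv.
have from_b x : x \in A -> agree x y -> b x w -> b y w -> g x y.
  move=> Ax axy bx byw; have : b x y by apply: (tb x w y) => //; exact: sb.
  by have := xorA Ax Ay; rewrite axy; case: (b x y) (g x y) => [] [].
have from_g x : x \in A -> g x w -> g y w -> g x y.
  by move=> Ax gx gyw; apply: (tg x w y) => //; exact: sg.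
(* One of [u], [v] is tied to [w] by [g] and the other by [b]. The one using the same relation as
   [y] is tied to [y] by it, and on a single run [b] and [g] coincide. *)
case: (boolP (g u w)) => gu; case: (boolP (g v w)) => gv //=; rewrite ?addbF ?addbT;
  case: (boolP (g y w)) => gy; rewrite ?addbF ?addbT => bv bu _ by_.
- by rewrite (from_g u).
- by rewrite (from_b v) ?orbT.
- by rewrite (from_g v) ?orbT.
- by rewrite (from_b u).
Qed.

(** A point [y] outside the runs of [i] and [j] and not [b]-tied to them would be [g]-tied to both,
    so the inversion of [i] and [j] would lie in both relations. *)
Lemma uncut_cover i j : i \in A -> j \in A ->
  {in A &, forall u v, agree u v -> b u v} -> ~~ agree i j -> b i j ->
  {in A, forall y, b i y}.
Proof.
move=> Ai Aj unc nij bij y Ay.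
have [[rb sb tb _] [rg sg tg _] _ _ _] := cert.
have [aiy|niy] := boolP (agree i y); first exact: unc.
have [ajy|njy] := boolP (agree j y).
  by apply: (tb i j y) => //; exact: unc.
apply: contraT => nbiy.
have giy : g i y by have := xorA Ai Ay; rewrite niy (negbTE nbiy).
have nbjy : ~~ b j y by apply: contra nbiy; exact: tb.
have gjy : g j y by have := xorA Aj Ay; rewrite njy (negbTE nbjy).
have gij : g i j by apply: (tg i y j) => //; exact: sg.
by have := xorA Ai Aj; rewrite nij bij gij.
Qed.

End Trichotomy.

End Classes.

Section KinSwap.
Variables (T : finType) (p q : T -> nat).

Lemma kinC : kin q p =2 kin p q.
Proof. by move=> i j; rewrite /kin (nearC p q q) (nearC p q p) andbC. Qed.

Lemma kin_classC : kin_class q p =1 kin_class p q.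
Proof. by move=> c; apply/setP => j; rewrite !inE kinC topC. Qed.

End KinSwap.

(** The largest set needed, in [small_class]: 2(s+t)+1 points of a class, the 2 points of an
    inversion, and at most t+1 and s+1 points refuting the two undivided arrangements. *)
Definition local_bound (s t : capacity) := 3 * (cap_size s + cap_size t) + 5.

Definition locally_certified (T : finType) (p q : T -> nat) s t :=
  forall A : {set T}, #|A| <= local_bound s t ->
    exists b g, local_certificate p q s t A b g.

(** Under a demand the block extends beyond the class; its size is then controlled for the whole
    column by [column_le], and here the class only has to be undivided. *)
Definition class_certificate (T : finType) (p q : T -> nat) s t c (b g : rel T) :=
  [/\ conv_equiv p (kin_class p q c) b, conv_equiv q (kin_class p q c) g,
      {in kin_class p q c &, forall i j, b i j (+) g i j = ~~ agree p q i j},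
      (if demand p q c then {in kin_class p q c &, forall i j, b i j}
       else classes_le s (kin_class p q c) b) &
      (if demand q p c then {in kin_class p q c &, forall i j, g i j}
       else classes_le t (kin_class p q c) g)].

Lemma locally_certified_swap (T : finType) (p q : T -> nat) s t :
  locally_certified p q s t -> locally_certified q p t s.
Proof.
move=> H A; rewrite /local_bound [cap_size t + _]addnC => cA; have [b [g cert]] := H A cA.
by exists g, b; exact: local_certificate_swap.
Qed.

Lemma class_certificate_swap (T : finType) (p q : T -> nat) s t c b g :
  class_certificate p q s t c b g -> class_certificate q p t s c g b.
Proof.
case=> cb cg x db dg; split; rewrite 1?(kin_classC p q) //.
by move=> i j Ci Cj; rewrite addbC agreeC x.
Qed.

(** * Bounds read off from local certificates *)

Section Sizes.
Variables (T : finType) (p q : T -> nat) (s t : capacity).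
Hypotheses (injp : injective p) (injq : injective q).
Hypothesis LC : locally_certified p q s t.

Local Notation agree := (agree p q).
Local Notation top := (top p q).
Local Notation linked := (linked p q).
Local Notation near := (near p q).
Local Notation kin := (kin p q).
Local Notation kin_class := (kin_class p q).

Lemma kinE i j : kin i j = near p i j && near q i j.
Proof. by []. Qed.

Lemma kin_sym i j : kin i j = kin j i.
Proof. by rewrite !kinE !(near_sym _ _ _ i). Qed.

Lemma nearq_refl i : near q i i.
Proof. by rewrite -nearC near_refl. Qed.

Lemma nearq_trans i j k : near q i j -> near q j k -> near q i k.
Proof. by rewrite -![near q _ _]nearC; exact: near_trans. Qed.

Lemma kin_refl i : kin i i.
Proof. by rewrite kinE near_refl nearq_refl. Qed.

Lemma kin_trans i j k : kin i j -> kin j k -> kin i k.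
Proof.
move=> /andP[p1 q1] /andP[p2 q2].
by rewrite kinE (near_trans injp injq p1 p2) (nearq_trans q1 q2).
Qed.

Lemma kin_in_class c i j : i \in kin_class c -> j \in kin_class c -> kin i j.
Proof.
rewrite !inE => /andP[_ ci] /andP[_ cj].
by apply: kin_trans cj; rewrite kin_sym.
Qed.

Lemma ntop_class c i : i \in kin_class c -> ~~ top i.
Proof. by rewrite inE => /andP[]. Qed.

(** A certified inversion shares one of the blocks, so it cannot be cut in both. *)
Lemma near_or i j : linked i j -> ~~ agree i j -> near p i j || near q i j.
Proof.
move=> lij nij; have [|b [g [_ _ _ _ R]]] := LC (A := [set i; j]).
  by rewrite cards2 /local_bound; case: (_ != _); lia.
have [||//|xor nb ng] := R i j; rewrite ?inE ?eqxx ?orbT //.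
apply: contraT; rewrite negb_or => /andP[/nb/negbTE nb' /ng/negbTE ng'].
by move: xor; rewrite nb' ng' nij.
Qed.

(** The point [o] forces [i] and [j] into one push block and [o'] forces them into one pop block,
    which an inversion does not allow. *)
Lemma no_double_demand i j o o' : ~~ top i -> ~~ top j -> ~~ top o -> ~~ top o' ->
  kin i j -> near p i o -> ~~ near q i o -> near q i o' -> ~~ near p i o' ->
  agree i j.
Proof.
move=> ti tj to to' kij pio qio qio' pio'.
have [|b [g cert]] := LC (A := [set i; j; o; o']).
  rewrite -setUA; apply: leq_trans (leq_card_setU _ _) _.
  by rewrite !cards2 /local_bound; clear; do 2!case: (_ != _); lia.
have Ai : i \in [set i; j; o; o'] by rewrite !inE eqxx.
have Aj : j \in [set i; j; o; o'] by rewrite !inE eqxx orbT.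
have Ao : o \in [set i; j; o; o'] by rewrite !inE eqxx !orbT.
have Ao' : o' \in [set i; j; o; o'] by rewrite !inE eqxx !orbT.
have [[_ sb tb _] [_ sg tg _] _ _ R] := cert.
have /andP[pij qij] := kij.
have pjo : near p j o by apply: near_trans pio => //; rewrite near_sym.
have qjo : ~~ near q j o by apply: contra qio; exact: nearq_trans.
have qjo' : near q j o' by apply: nearq_trans qio'; rewrite near_sym.
have pjo' : ~~ near p j o' by apply: contra pio'; exact: near_trans.
have dem := demanded injp injq cert.
have dem' := demanded injq injp (local_certificate_swap cert).
have bij : b i j.
  by apply: (tb i o j) => //; [exact: dem|apply: sb => //; exact: dem].
have gij : g i j.
  apply: (tg i o' j) => //; [|apply: sg => //];
  by apply: dem' => //; rewrite (topC, nearC) //.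
have [|xor _ _] := R i j Ai Aj; first exact: near_linked pij.
by move: xor; rewrite bij gij /=; case: (agree i j).
Qed.

(** Each point of the column is tied to [c], directly if it lies outside the class of [c] and
    through [o] otherwise. So s+1 of them together with [c] and [o] would already overfill a push
    block. *)
Lemma column_le c o : ~~ top c -> ~~ top o -> near p c o -> ~~ near q c o ->
  cap_ok s #|[set j | ~~ top j && near p c j]|.
Proof.
move=> tc to pco qco; apply: contraT => /cap_okPn[m es lt].
have [B sB cB] := subset_of_card lt.
have [|b [g cert]] := LC (A := B :|: [set c; o]).
  apply: leq_trans (card_setU_le (leqnn _) (leqnn _)) _.
  by rewrite cB cards2 /local_bound es /=; case: (_ != _); lia.
set A := B :|: _ in cert.
have Ac : c \in A by rewrite !inE eqxx orbT.
have Ao : o \in A by rewrite !inE eqxx !orbT.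
have [[rb sb tb _] _ le _ _] := cert.
have dem := demanded injp injq cert.
have BA x : x \in B -> b c x.
  move=> Bx; have Ax : x \in A by rewrite inE Bx.
  have := subsetP sB x Bx; rewrite inE => /andP[tx pcx].
  have [qcx|qcx] := boolP (near q c x); last exact: dem.
  apply: (tb c o x) => //; first exact: dem.
  apply: dem => //; first by apply: near_trans pcx => //; rewrite near_sym.
  apply: contra qco => qox; apply: nearq_trans qcx _; by rewrite near_sym.
have := le c Ac; rewrite es /= leqNgt => /negP[].
rewrite -cB; apply: subset_leq_card; apply/subsetP => x Bx.
by rewrite !inE Bx BA.
Qed.

(** The demand of [o] puts the class into one push block; on a run the exclusive or then yields one
    pop block, which t+1 points would overfill. *)
Lemma strip_le c o : ~~ top c -> ~~ top o -> near p c o -> ~~ near q c o ->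
  cap_ok t #|[set j in kin_class c | agree c j]|.
Proof.
move=> tc to pco qco; apply: contraT => /cap_okPn[m et lt].
have [B sB cB] := subset_of_card lt.
have [|b [g cert]] := LC (A := B :|: [set c; o]).
  apply: leq_trans (card_setU_le (leqnn _) (leqnn _)) _.
  by rewrite cB cards2 /local_bound et /=; case: (_ != _); lia.
set A := B :|: _ in cert.
have Ac : c \in A by rewrite !inE eqxx orbT.
have Ao : o \in A by rewrite !inE eqxx !orbT.
have [[rb sb tb _] _ _ le R] := cert.
have dem := demanded injp injq cert.
have BA x : x \in B -> g c x.
  move=> Bx; have Ax : x \in A by rewrite inE Bx.
  have := subsetP sB x Bx; rewrite !inE => /andP[/andP[tx /andP[pcx qcx]] acx].
  have bcx : b c x.
    apply: (tb c o x) => //; first exact: dem.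
    apply: sb => //; apply: dem => //; first by apply: near_trans pco => //; rewrite near_sym.
    by apply: contra qco; exact: nearq_trans.
  have [|xor _ _] := R c x Ac Ax; first exact: near_linked pcx.
  by move: xor; rewrite bcx acx; case: (g c x).
have := le c Ac; rewrite et /= leqNgt => /negP[].
rewrite -cB; apply: subset_leq_card; apply/subsetP => x Bx.
by rewrite !inE Bx BA.
Qed.

Lemma conv_equiv_all f (A : {set T}) : conv_equiv f A (fun _ _ => true).
Proof. by split. Qed.

Lemma conv_equiv_eq f (A : {set T}) : conv_equiv f A eq_op.
Proof.
split=> [x _|x y _ _|x y z _ _ _|x y z _ _ _]; rewrite ?eqxx //.
- by move/eqP->.
- by move=> /eqP->.
- by move=> xy yz /eqP e; move: xy yz; rewrite e; lia.
Qed.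

Lemma conv_equiv_agree c : conv_equiv q (kin_class c) agree.
Proof.
split.
- by move=> x _; exact: agree_refl.
- by move=> x y _ _; rewrite agree_sym.
- move=> x y z Cx Cy Cz.
  by apply: agree_trans => //; [case/andP: (kin_in_class Cx Cy)|case/andP: (kin_in_class Cy Cz)].
- move=> x y z Cx Cy Cz xy yz /(agreeP injp injq)[e|xz|zx].
  + by move: xy yz; rewrite e; lia.
  + have /andP[pxz _] := kin_in_class Cx Cz.
    have := near_not_bad pxz; apply: contraR => ny.
    apply: (bad_split_by xz (r := y)); move: ny; rewrite agreeE split_byE xy yz /=.
    by move: xz; rewrite ascE; lia.
  + by move: zx; rewrite ascE; lia.
Qed.

(** Push the class undivided and pop it run by run. *)
Lemma whole_class_certificate c :
  (demand p q c || cap_ok s #|kin_class c|) -> ~~ demand q p c ->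
  {in kin_class c, forall x, cap_ok t #|[set y in kin_class c | agree x y]|} ->
  exists b g, class_certificate p q s t c b g.
Proof.
move=> H1 H2 H3; exists (fun _ _ => true), agree; split.
- exact: conv_equiv_all.
- exact: conv_equiv_agree.
- by move=> i j _ _; rewrite addTb.
- case: (demand p q c) H1 => //= H1 x Cx; apply: cap_ok_leq H1.
  by apply: subset_leq_card; apply/subsetP => y; rewrite !inE => /andP[].
- by rewrite (negbTE H2).
Qed.

Lemma demand_class_certificate c : ~~ top c -> demand p q c -> ~~ demand q p c ->
  exists b g, class_certificate p q s t c b g.
Proof.
move=> tc dc nd; apply: whole_class_certificate; rewrite ?dc //.
case/existsP: dc => o /and3P[to pco qco] x Cx.
have tx := ntop_class Cx; have := Cx; rewrite inE => /andP[_ /andP[pcx qcx]].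
have Ex : kin_class c = kin_class x.
  apply/setP => y; rewrite !inE; congr (_ && _).
  by apply/idP/idP; apply: kin_trans; rewrite ?[kin x c]kin_sym kinE pcx.
rewrite Ex; apply: (strip_le tx to); first by apply: near_trans pco => //; rewrite near_sym.
by apply: contra qco; exact: nearq_trans.
Qed.

(** By [cut_cover] the pop classes of [u] and [v] cover [A]. *)
Lemma cut_bound (A : {set T}) b g u v i j m :
  local_certificate p q s t A b g ->
  {in A &, forall x y, kin x y} -> {in A, forall x, ~~ top x} ->
  u \in A -> v \in A -> i \in A -> j \in A ->
  agree u v -> ~~ b u v -> ~~ agree i j -> t = Some m -> #|A| <= m + m.
Proof.
move=> cert kA tA Au Av Ai Aj auv nuv nij et.
have cov := cut_cover injp injq cert kA tA Au Av Ai Aj auv nuv nij.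
have [_ _ _ le _] := cert.
have := le u Au; have := le v Av; rewrite et /= => lv lu.
apply: leq_trans (card_setU_le lu lv); apply: subset_leq_card.
by apply/subsetP => y Ay; rewrite !inE Ay /= cov.
Qed.

(** Why the class cannot be pushed undivided: either it exceeds s, and then the size of [A]
    suffices, or [S] consists of t+1 points of one run, which a common push block would force into a
    common pop block. *)
Lemma refute_whole c :
  ~~ (cap_ok s #|kin_class c| &&
      [forall x in kin_class c, cap_ok t #|[set y in kin_class c | agree x y]|]) ->
  exists2 S : {set T}, S \subset kin_class c /\ #|S| <= (cap_size t).+1 &
    forall (A : {set T}) b g, S \subset A -> A \subset kin_class c ->
      (cap_size s) < #|A| -> local_certificate p q s t A b g ->
      forall i, i \in A -> {in A, forall y, b i y} -> False.
Proof.
rewrite negb_and => /orP[/cap_okPn[m es lt]|].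
  exists set0; rewrite ?sub0set ?cards0 // => A b g _ _ + [_ _ le _ _] i Ai bi.
  rewrite es /= ltnNge => /negP[]; have := le i Ai; rewrite es /=.
  by apply: leq_trans; apply: subset_leq_card; apply/subsetP => y Ay; rewrite inE Ay bi.
rewrite negb_forall_in => /exists_inP[x Cx /cap_okPn[m et lt]].
have [S sS cS] := subset_of_card lt.
have SC y : y \in S -> y \in kin_class c by move/(subsetP sS); rewrite inE => /andP[].
exists S; first by split; [exact/subsetP|rewrite cS et].
move=> A b g sSA sAC _ [[_ sb tb _] _ _ le R] i Ai bi.
have [y Sy] : exists y, y \in S by apply/set0Pn; rewrite -card_gt0 cS.
have Ay := subsetP sSA y Sy; have := le y Ay; rewrite et /= leqNgt => /negP[].
rewrite -cS; apply: subset_leq_card; apply/subsetP => z Sz.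
have Az := subsetP sSA z Sz; rewrite inE Az /=.
have byz : b y z by apply: (tb y i z) => //; [apply: sb => //|]; exact: bi.
have /andP[pyz _] := kin_in_class (SC _ Sy) (SC _ Sz).
have [|xor _ _] := R y z Ay Az.
  exact: (near_linked injp injq (ntop_class (SC _ Sy)) (ntop_class (SC _ Sz)) pyz).
have ayz : agree y z.
  have [_ sa ta _] := conv_equiv_agree c.
  have := subsetP sS y Sy; have := subsetP sS z Sz.
  rewrite !(inE, in_setT) => /andP[_ xz] /andP[_ xy].
  by apply: (ta y x z) => //; rewrite ?SC //; apply: sa => //; exact: SC.
by move: xor; rewrite byz ayz; case: (g y z).
Qed.

End Sizes.

(** * Certificates for single classes *)

Section Assembly.
Variables (T : finType) (p q : T -> nat) (s t : capacity).
Hypotheses (injp : injective p) (injq : injective q).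
Hypotheses (sval : cap_valid s) (tval : cap_valid t).
Hypothesis LC : locally_certified p q s t.

Local Notation agree' := (agree q p).
Local Notation top' := (top q p).
Local Notation kin' := (kin q p).
Local Notation kin_class' := (kin_class q p).
Local Notation agree := (agree p q).
Local Notation top := (top p q).
Local Notation kin := (kin p q).
Local Notation kin_class := (kin_class p q).

(** In a larger set either some run is cut, and two blocks cover everything, or no run is cut and
    the inversion of [i] and [j] forces the set to be undivided in [b] or in [g], both of which are
    refuted. *)
Lemma small_class c i j : i \in kin_class c -> j \in kin_class c -> ~~ agree i j ->
  ~~ (cap_ok s #|kin_class c| &&
      [forall x in kin_class c, cap_ok t #|[set y in kin_class c | agree x y]|]) ->
  ~~ (cap_ok t #|kin_class c| &&
      [forall x in kin_class c, cap_ok s #|[set y in kin_class c | agree x y]|]) ->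
  #|kin_class c| <= 2 * (cap_size s + cap_size t).
Proof.
move=> Ci Cj nij Hb Hg; rewrite leqNgt; apply/negP => big.
have [A0 sA0 cA0] := subset_of_card big.
have [Sb [sSb cSb] Rb] := refute_whole injp injq Hb.
have Hg' : ~~ (cap_ok t #|kin_class' c| && [forall x in kin_class' c,
      cap_ok s #|[set y in kin_class' c | agree' x y]|]).
  move: Hg; rewrite kin_classC; congr (~~ (_ && _)); apply: eq_forallb => x.
  by congr (_ ==> cap_ok _ #|pred_of_set _|); apply/setP => y; rewrite !inE agreeC.
have [Sg [sSg cSg] Rg] := refute_whole injq injp Hg'.
rewrite kin_classC in sSg Rg.
pose A := A0 :|: [set i; j] :|: Sb :|: Sg.
have sAC : A \subset kin_class c.
  by rewrite !subUset sA0 sSb sSg !sub1set Ci Cj.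
have Ai : i \in A by rewrite !inE eqxx ?orbT.
have Aj : j \in A by rewrite !inE eqxx ?orbT.
have sSbA : Sb \subset A by rewrite /A -setUA setUCA subsetUl.
have sSgA : Sg \subset A by rewrite subsetUr.
have bigA : 2 * (cap_size s + cap_size t) < #|A|.
  by rewrite -cA0; apply: subset_leq_card; rewrite /A -!setUA subsetUl.
have [|b [g cert]] := LC (A := A).
  have c2 : #|[set i; j]| <= 2 by rewrite cards2; case: (_ != _).
  apply: leq_trans (card_setU_le (card_setU_le (card_setU_le (leqnn _) c2) cSb) cSg) _.
  by rewrite cA0 /local_bound; clear; lia.
have cert' := local_certificate_swap cert.
have kA : {in A &, forall x y, kin x y}.
  by move=> x y /(subsetP sAC) Cx /(subsetP sAC) Cy; exact: kin_in_class Cx Cy.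
have tA : {in A, forall x, ~~ top x} by move=> x /(subsetP sAC)/ntop_class.
have kA' : {in A &, forall x y, kin' x y} by move=> x y Ax Ay; rewrite kinC kA.
have tA' : {in A, forall x, ~~ top' x} by move=> x Ax; rewrite topC tA.
have nij' : ~~ agree' i j by rewrite agreeC.
have xorb := xorA injp injq cert kA tA.
have [/existsP[u /existsP[v /and4P[Au Av auv nuv]]]|unc] :=
    boolP [exists u, exists v, [&& u \in A, v \in A, agree u v & ~~ b u v]].
  have nguv : ~~ g u v by have := xorb u v Au Av; rewrite auv (negbTE nuv) => /= ->.
  (* Two infinite capacities would contradict [Hb]; as the run is cut in both relations, either
     finite capacity gives the bound. *)
  have [[m et]|[m es]] : (exists m, t = Some m) \/ (exists m, s = Some m).
  - case: (s) (t) Hb => [m|] [m'|]; [by left; exists m'|by right; exists m|by left; exists m'|].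
    by case/negP; apply/forall_inP.
  - have := cut_bound injp injq cert kA tA Au Av Ai Aj auv nuv nij et.
    by move: bigA; rewrite et /=; clear; lia.
  - have auv' : agree' u v by rewrite agreeC.
    have := cut_bound injq injp cert' kA' tA' Au Av Ai Aj auv' nguv nij' es.
    by move: bigA; rewrite es /=; clear; lia.
have uncb : {in A &, forall u v, agree u v -> b u v}.
  move=> u v Au Av auv; apply: contraR unc => nuv.
  by apply/existsP; exists u; apply/existsP; exists v; apply/and4P.
have uncg : {in A &, forall u v, agree' u v -> g u v}.
  move=> u v Au Av; rewrite agreeC => auv; have := xorb u v Au Av.
  by rewrite auv uncb //; case: (g u v).
have := xorb i j Ai Aj; rewrite nij /=; have [bij _|nbij /= gij] := boolP (b i j).
  apply: (Rb A b g sSbA sAC _ cert i Ai); first by move: bigA; clear; lia.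
  exact: (uncut_cover injp injq cert kA tA Ai Aj uncb nij bij).
apply: (Rg A g b sSgA sAC _ cert' i Ai); first by move: bigA; clear; lia.
exact: (uncut_cover injq injp cert' kA' tA' Ai Aj uncg nij' gij).
Qed.

(** With demands from both sides the class is one run and stays undivided in both relations; with
    one demand it is undivided on that side. Without demands it is undivided on a side where the
    sizes permit; failing that, it is small and certified as one local set, or it has no inversion
    and singletons do. *)
Lemma class_certificate_exists c : ~~ top c ->
  exists b g, class_certificate p q s t c b g.
Proof.
move=> tc; have tc' : ~~ top' c by rewrite topC.
have LC' := locally_certified_swap LC.
have [dp|dp] := boolP (demand p q c); have [dq|dq] := boolP (demand q p c).
- exists (fun _ _ => true), (fun _ _ => true); split; rewrite ?dp ?dq //;
    try exact: conv_equiv_all.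
  move=> i j Ci Cj; suff -> : agree i j by [].
  case/existsP: dp => o /and3P[to pco qco].
  case/existsP: dq => o' /and3P[]; rewrite topC !(nearC p q) => to' qco' pco'.
  have kij := kin_in_class injp injq Ci Cj.
  have : kin i c by rewrite kin_sym; move: Ci; rewrite inE => /andP[].
  move=> /andP[pic qic].
  apply: (no_double_demand injp injq LC (ntop_class Ci) (ntop_class Cj) to to' kij).
  + exact: (near_trans injp injq pic pco).
  + by apply: contra qco; apply: nearq_trans => //; rewrite near_sym.
  + exact: (nearq_trans injp injq qic qco').
  + by apply: contra pco'; apply: near_trans => //; rewrite near_sym.
- exact: demand_class_certificate.
- have [g [b cert]] := demand_class_certificate injq injp LC' tc' dq dp.
  by exists b, g; exact: class_certificate_swap.
have [Pb|Pb] := boolP (cap_ok s #|kin_class c| &&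
      [forall x in kin_class c, cap_ok t #|[set y in kin_class c | agree x y]|]).
  case/andP: Pb => cs /forall_inP ct; apply: whole_class_certificate => //.
  by rewrite cs orbT.
have [Pg|Pg] := boolP (cap_ok t #|kin_class c| &&
      [forall x in kin_class c, cap_ok s #|[set y in kin_class c | agree x y]|]).
  case/andP: Pg => ct /forall_inP cs.
  have [|x Cx|g [b cert]] := @whole_class_certificate _ q p t s injq injp c _ dp.
  - by rewrite kin_classC ct orbT.
  - rewrite kin_classC in Cx *; have := cs x Cx; congr (cap_ok _ #|pred_of_set _|).
    by apply/setP => y; rewrite !inE agreeC.
  by exists b, g; exact: class_certificate_swap.
have [/exists_inP[i Ci /exists_inP[j Cj nij]]|ag] :=
    boolP [exists i in kin_class c, exists j in kin_class c, ~~ agree i j].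
  have sm := small_class Ci Cj nij Pb Pg.
  have [|b [g cert]] := LC (A := kin_class c).
    by apply: leq_trans sm _; rewrite /local_bound; clear; lia.
  exists b, g; have [cb cg lb lg _] := cert; split; rewrite ?(negbTE dp) ?(negbTE dq) //.
  apply: (xorA injp injq cert); last by move=> x; exact: ntop_class.
  by move=> x y Cx Cy; exact: kin_in_class Cx Cy.
have class1 x : #|[set y in kin_class c | x == y]| <= 1.
  rewrite -(cards1 x); apply: subset_leq_card; apply/subsetP => y.
  by rewrite !inE eq_sym => /andP[].
exists eq_op, eq_op; split; rewrite ?(negbTE dp) ?(negbTE dq).
- exact: conv_equiv_eq.
- exact: conv_equiv_eq.
- move=> i j Ci Cj; rewrite addbb; apply/esym/negbTE; rewrite negbK.
  apply: contraR ag => nij; apply/exists_inP; exists i => //.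
  by apply/exists_inP; exists j.
- by move=> x Cx; apply: cap_ok_leq (class1 x) _; case: (s) sval.
- by move=> x Cx; apply: cap_ok_leq (class1 x) _; case: (t) tval.
Qed.

End Assembly.

(** * From local to global certificates *)

(* The points of the staircase [top] are pushed and popped on their own; [l c]
   refines the class of [c]. *)
Definition glue (T : finType) (p q : T -> nat) (l : T -> rel T) : rel T :=
  fun i j => (i == j) || [&& ~~ top p q i, ~~ top p q j, near p q p i j &
                             near p q q i j ==> l i i j].

Section Glue.
Variables (T : finType) (p q : T -> nat) (s t : capacity) (l : T -> rel T).
Hypotheses (injp : injective p) (injq : injective q) (sval : cap_valid s).
Hypothesis LC : locally_certified p q s t.

Local Notation top := (top p q).
Local Notation near := (near p q).
Local Notation kin := (kin p q).
Local Notation kin_class := (kin_class p q).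
Local Notation glue := (glue p q l).

Hypothesis l_kin : forall i j, ~~ top i -> ~~ top j -> kin i j -> l i = l j.
Hypothesis l_conv : forall c, ~~ top c -> conv_equiv p (kin_class c) (l c).
Hypothesis l_size : forall c, ~~ top c ->
  if demand p q c then {in kin_class c &, forall i j, l c i j}
  else classes_le s (kin_class c) (l c).

Lemma glueP i j : reflect (i = j \/ [/\ ~~ top i, ~~ top j, near p i j &
  (near q i j -> l i i j)]) (glue i j).
Proof.
apply: (iffP orP) => [[/eqP|/and4P[ti tj pij /implyP]]|[->|[ti tj pij H]]].
- by left.
- by right.
- by left.
- by right; apply/and4P; split=> //; exact/implyP.
Qed.

Lemma mem_self c : ~~ top c -> c \in kin_class c.
Proof. by move=> tc; rewrite inE tc kin_refl. Qed.

Lemma demand_whole c i j : ~~ top c -> demand p q c ->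
  i \in kin_class c -> j \in kin_class c -> l c i j.
Proof. by move=> tc dc; have := l_size tc; rewrite dc; exact. Qed.

Lemma glue_conv : conv_equiv p [set: T] glue.
Proof.
split.
- by move=> x _; apply/glueP; left.
- move=> x y _ _ /glueP[->|[tx ty pxy H]]; first by apply/glueP; left.
  apply/glueP; right; split; rewrite 1?near_sym // => qxy.
  have kxy : kin x y by rewrite kinE pxy.
  rewrite -(l_kin tx ty kxy); have [_ sl _ _] := l_conv tx.
  by apply: sl; rewrite ?mem_self ?inE ?ty //; exact: H.
- move=> x y z _ _ _ /glueP[->//|[tx ty pxy Hxy]] /glueP[<-|[_ tz pyz Hyz]].
    by apply/glueP; right.
  have pxz : near p x z by exact: (near_trans injp injq pxy pyz).
  apply/glueP; right; split=> // qxz.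
  have Cz : z \in kin_class x by rewrite inE tz kinE pxz.
  (* If [y] lies outside the class of [x] and [z], it is itself a demand, so the class is
     undivided. *)
  have [qxy|qxy] := boolP (near q x y); last first.
    by apply: demand_whole; rewrite ?mem_self //; exact: demandP qxy.
  have kxy : kin x y by rewrite kinE pxy.
  have Cy : y \in kin_class x by rewrite inE ty.
  have [_ _ tl _] := l_conv tx; apply: (tl x y z); rewrite ?mem_self ?Hxy //.
  rewrite (l_kin tx ty kxy); apply: Hyz.
  by apply: nearq_trans qxz => //; rewrite near_sym.
- move=> x y z _ _ _ xy yz /glueP[e|[tx tz pxz Hxz]].
    by move: xy yz; rewrite e; clear; lia.
  have ty : ~~ top y.
    by apply/negP => ty; apply: (top_between injp injq tx ty xy (ltnW yz) pxz).
  have pxy : near p x y.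
    by apply: near_sub pxz _; rewrite hullE (ltnW xy) (ltnW yz).
  apply/glueP; right; split=> // qxy.
  have Cy : y \in kin_class x by rewrite inE ty kinE pxy.
  have [qxz|qxz] := boolP (near q x z); last first.
    by apply: demand_whole; rewrite ?mem_self //; exact: demandP qxz.
  have Cz : z \in kin_class x by rewrite inE tz kinE pxz.
  by have [_ _ _ cl] := l_conv tx; apply: (cl x y z); rewrite ?mem_self ?Hxz.
Qed.

Lemma glue_size : classes_le s [set: T] glue.
Proof.
move=> x _; have [tx|tx] := boolP (top x).
  apply: (@cap_ok_leq _ _ 1); last by case: (s) sval.
  rewrite -(cards1 x); apply: subset_leq_card; apply/subsetP => y.
  by rewrite !inE => /glueP[->//|[]]; rewrite tx.
have [dx|dx] := boolP (demand p q x).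
  case/existsP: dx => o /and3P[to pxo qxo].
  apply: cap_ok_leq (column_le injp injq LC tx to pxo qxo).
  apply: subset_leq_card; apply/subsetP => y.
  by rewrite !inE => /glueP[<-|[_ -> ->//]]; rewrite tx near_refl.
have := l_size tx; rewrite (negbTE dx) => /(_ x (mem_self tx)).
apply: cap_ok_leq; apply: subset_leq_card; apply/subsetP => y.
have [rl _ _ _] := l_conv tx.
rewrite !inE => /glueP[<-|[_ ty pxy H]]; first by rewrite tx kin_refl rl ?mem_self.
have qxy : near q x y by apply: contraR dx => qxy; exact: demandP qxy.
by rewrite ty kinE pxy qxy H.
Qed.

(** Otherwise the top point [m] would lie between two points of one push class, against
    [top_between]. *)
Lemma glue_below_top j k m : (p j < p k) || glue j k -> j <> k ->
  top m -> asc p q k m -> p j < p m.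
Proof.
move=> jk njk tm /[dup] km /andP[lt_km _].
case/orP: jk => [/ltn_trans|/glueP[//|[tj tk pjk _]]]; first exact.
rewrite ltnNge; apply/negP => mj.
by apply: (top_between injp injq tk tm lt_km mj); rewrite near_sym.
Qed.

End Glue.

Section KinInvariance.
Variables (T : finType) (p q : T -> nat).
Hypotheses (injp : injective p) (injq : injective q).

Local Notation kin := (kin p q).
Local Notation kin_class := (kin_class p q).
Local Notation demand := (demand p q).

Lemma kin_class_eq i j : kin i j -> kin_class i = kin_class j.
Proof.
move=> kij; apply/setP => y; rewrite !inE; congr (_ && _).
by apply/idP/idP; apply: kin_trans; rewrite // kin_sym.
Qed.

Lemma demand_kin i j : kin i j -> demand i -> demand j.
Proof.
move=> /andP[pij qij] /existsP[o /and3P[to pio qio]]; apply: demandP to _ _.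
  by apply: near_trans pio => //; rewrite near_sym.
by apply: contra qio; exact: nearq_trans.
Qed.

End KinInvariance.

Lemma demand_eq (T : finType) (p q : T -> nat) i j : injective p -> injective q ->
  kin p q i j -> demand p q i = demand p q j.
Proof. by move=> injp injq k; apply/idP/idP; apply: demand_kin; rewrite // kin_sym. Qed.

Section Global.
Variables (T : finType) (p q : T -> nat) (s t : capacity).
Hypotheses (injp : injective p) (injq : injective q).
Hypotheses (sval : cap_valid s) (tval : cap_valid t).
Hypothesis LC : locally_certified p q s t.

(** The choice is indexed by the class as a set, so that kin points receive the same relations. *)
Lemma class_choice : exists lb lg : T -> rel T,
  (forall i j, ~~ top p q i -> ~~ top p q j -> kin p q i j -> lb i = lb j /\ lg i = lg j) /\
  (forall c, ~~ top p q c -> class_certificate p q s t c (lb c) (lg c)).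
Proof.
have /fin_all_exists[F HF] : forall C : {set T}, exists bg : rel T * rel T,
    forall c, ~~ top p q c -> kin_class p q c = C -> class_certificate p q s t c bg.1 bg.2.
  move=> C; have [/exists_inP[c tc /eqP Cc]|no] :=
      boolP [exists c in predC (top p q), kin_class p q c == C].
    have [b [g cert]] := class_certificate_exists injp injq sval tval LC tc.
    exists (b, g) => c' tc' Cc' /=.
    have kcc : kin p q c c'.
      have : c' \in kin_class p q c by rewrite Cc -Cc' mem_self.
      by rewrite inE => /andP[].
    case: cert => cb cg x db dg; rewrite Cc -Cc' in cb cg x db dg.
    split=> //; first by rewrite -(demand_eq injp injq kcc).
    by rewrite -(demand_eq injq injp (i := c)) // kinC.
  exists (eq_op, eq_op) => c tc Cc; case/negP: no; apply/exists_inP.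
  by exists c; rewrite ?inE //; apply/eqP.
exists (fun c => (F (kin_class p q c)).1), (fun c => (F (kin_class p q c)).2); split.
  by move=> i j _ _ kij; rewrite (kin_class_eq injp injq kij).
by move=> c tc; exact: HF.
Qed.

Theorem certificate_of_local : exists b g, certificate p q s t [set: T] b g.
Proof.
have [lb [lg [lkin lcert]]] := class_choice.
have LC' := locally_certified_swap LC.
have Hlb i j : ~~ top p q i -> ~~ top p q j -> kin p q i j -> lb i = lb j.
  by move=> ti tj k; case: (lkin i j ti tj k).
have Hlg i j : ~~ top q p i -> ~~ top q p j -> kin q p i j -> lg i = lg j.
  by rewrite !(topC p q) kinC => ti tj k; case: (lkin i j ti tj k).
have Cb c : ~~ top p q c -> conv_equiv p (kin_class p q c) (lb c).
  by case/lcert.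
have Cg c : ~~ top q p c -> conv_equiv q (kin_class q p c) (lg c).
  by rewrite topC kin_classC => /lcert[].
have Db c : ~~ top p q c -> if demand p q c then {in kin_class p q c &, forall i j, lb c i j}
  else classes_le s (kin_class p q c) (lb c) by case/lcert.
have Dg c : ~~ top q p c -> if demand q p c then {in kin_class q p c &, forall i j, lg c i j}
  else classes_le t (kin_class q p c) (lg c) by rewrite topC kin_classC => /lcert[].
pose b := glue p q lb; pose g := glue q p lg.
have cb := glue_conv injp injq Hlb Cb Db; have cg := glue_conv injq injp Hlg Cg Dg.
exists b, g; split=> //; [exact: glue_size LC Cb Db|exact: glue_size LC' Cg Dg|].
have gP i j : reflect (i = j \/ [/\ ~~ top p q i, ~~ top p q j, near p q q i j &
    (near p q p i j -> lg i i j)]) (g i j).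
  by apply: (iffP (glueP _ _ _ _ _)); rewrite !(topC p q) !(nearC p q).
have bP i j := glueP p q lb i j.
have xor i j : ~~ top p q i -> ~~ top p q j -> near p q p i j -> near p q q i j ->
    lb i i j (+) lg i i j = ~~ agree p q i j.
  move=> ti tj pij qij; have [_ _ x _ _] := lcert i ti.
  by apply: x; rewrite ?mem_self // inE tj kinE pij.
have [_ sb _ _] := cb; have [_ sg _ _] := cg.
move=> i j _ _ ij; have nij : i <> j by move=> e; rewrite e ltnn in ij.
have [pnij qnij] := neq_coord injp injq nij.
(* On an increasing pair the two [near] relations coincide, and within a class the exclusive or
   equates [lb] and [lg]. *)
have [qij|qij] := ltnP (q i) (q j).
  have aij : asc p q i j by rewrite ascE ij.
  have ag := asc_agree aij.
  apply/bP/gP => -[//|[ti tj nr H]]; right.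
    have nr' := near_agree injp injq ag nr; split=> // _.
    by have := xor i j ti tj nr nr'; rewrite ag H //; case: (lg i i j).
  have nr' : near p q p i j.
    by rewrite -nearC; apply: (near_agree injq injp); rewrite (agreeC, nearC).
  split=> // _.
  by have := xor i j ti tj nr' nr; rewrite ag H //; case: (lb i i j).
have nag : ~~ agree p q i j by rewrite agreeE ij ltnNge qij.
split.
  apply/negP => /andP[/bP[//|[ti tj pij Hb]] /gP[//|[_ _ qij' Hg]]].
  by have := xor i j ti tj pij qij'; rewrite Hb // Hg // nag.
move=> nb ng k _; apply/negP => /andP[Hb Hg].
(* A point above and to the right of both [i] and [j], making them linked. If [k] is not one, it is
   glued to [j] or to [i], hence off the staircase, and a top point above [k] serves. *)
have [m jm im] : exists2 m, p j < p m & q i < q m.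
  have [/andP[]|] := boolP ((p j < p k) && (q i < q k)); first by exists k.
  move=> nk; have njk : j <> k.
    move=> e; move: Hg; rewrite -e (negbTE ng) orbF ltnNge => /negP[]; exact: qij.
  have nik : i <> k.
    move=> e; move: Hb; rewrite -e => /orP[|/sb].
      by rewrite ltnNge (ltnW ij).
    by move=> bij; case/negP: nb; apply: bij; rewrite inE.
  have tk : ~~ top p q k.
    move: nk; rewrite negb_and => /orP[/negbTE n|/negbTE n]; [move: Hb|move: Hg]; rewrite n /=.
      by move=> /bP[//|[]].
    by move=> /gP[//|[]].
  have [m tm km] := exists_top tk; exists m.
    exact: (glue_below_top injp injq (l := lb) Hb njk tm km).
  by apply: (glue_below_top injq injp (l := lg) Hg nik); rewrite (topC, ascC).
have lij : linked p q i j.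
  by apply/existsP; exists m; rewrite !ascE jm im (ltn_trans ij jm) (leq_ltn_trans qij im).
have ti : ~~ top p q i by apply: (@asc_ntop _ _ _ i m); rewrite ascE im (ltn_trans ij jm).
have tj : ~~ top p q j by apply: (@asc_ntop _ _ _ j m); rewrite ascE jm (leq_ltn_trans qij im).
have := near_or LC lij nag; case: (boolP (near p q p i j)) => pij; last first.
  move=> /= qij'; case/negP: ng; apply/gP; right; split=> // pij'.
  by rewrite pij' in pij.
move=> _; have [qij'|qij'] := boolP (near p q q i j); last first.
  by case/negP: nb; apply/bP; right; split=> // qij''; rewrite qij'' in qij'.
have := xor i j ti tj pij qij'; rewrite nag.
case: (boolP (lb i i j)) => [lbij _|_ /= lgij].
  by case/negP: nb; apply/bP; right.
by case/negP: ng; apply/gP; right.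
Qed.

End Global.

(** * Sorting runs and certificates *)

(* [b e] and [g e] are the times at which [e] is pushed and popped, counted
   from the current state. *)
Section Times.
Variables (b g : nat -> nat).

(** Ties are broken by value because a popped block keeps its order and the output increases
    downwards. *)
Definition pops_above : rel nat := fun e e' => (g e < g e') || (g e == g e') && (e < e').
Definition lands_on : rel nat := fun e e' => (b e' < g e) ==> pops_above e' e.
(** Within a push block the earlier element ends up above; across blocks the later one does. *)
Definition queued : rel nat := fun e e' =>
  (b e <= b e') && (if b e == b e' then pops_above e e' else lands_on e e').

Definition schedule (s t : capacity) (inp w : seq nat) : Prop :=
  [/\ pairwise queued inp, pairwise pops_above w, allrel lands_on w inp &
      all (fun e => 0 < b e < g e) inp && all (fun e => 0 < g e) w] /\
  [/\ {in inp ++ w &, forall e e', e < e' -> g e' <= g e},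
      forall m, cap_ok s (count (fun e => b e == m) inp) &
      forall m, cap_ok t (count (fun e => g e == m) (inp ++ w))].

End Times.

Lemma pops_aboveE g e e' :
  pops_above g e e' = (g e < g e') || (g e == g e') && (e < e').
Proof. by []. Qed.

(** Prepends a move: [a] receives push time 1 and later times shift by one. *)
Lemma schedule_push s t a c w b g : uniq (a ++ c) -> cap_ok s (size a) ->
  schedule b g s t c (a ++ w) ->
  schedule (fun e => if e \in c then (b e).+1 else 1) (fun e => (g e).+1) s t (a ++ c) w.
Proof.
move=> uac ca [[Pc]]; rewrite pairwise_cat allrel_catl => /and3P[Xaw Pa Pw] /andP[Xac Xwc].
rewrite all_cat => /and3P[/allP bc ga gw] [mono cb cg].
have nac e : e \in a -> (e \in c) = false.
  move=> ea; apply/negbTE; move: uac; rewrite cat_uniq => /and3P[_ /hasPn na _].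
  by apply/negP => /na /=; rewrite ea.
split; split.
- rewrite pairwise_cat; apply/and3P; split.
  + apply/allrelP => e e' ea ec; have /andP[b0 _] := bc _ ec.
    have := allrelP Xac _ _ ea ec; rewrite /queued /lands_on /pops_above (nac _ ea) ec.
    by rewrite !ltnS !eqSS; case: (b e') b0.
  + apply/(sub_in_pairwise (P := mem a)): Pa; last by apply/allP.
    move=> e e' ea ea'; rewrite /queued /pops_above !nac //=.
  + apply/(sub_in_pairwise (P := mem c)): Pc; last by apply/allP.
    by move=> e e' ec ec'; rewrite /queued /lands_on /pops_above !ec !ec' /= !ltnS !eqSS.
- exact: Pw.
- rewrite allrel_catr; apply/andP; split; apply/allrelP => e e' we.
    move=> ea; rewrite /lands_on (nac _ ea).
    by have := allrelP Xaw _ _ ea we; rewrite /pops_above => ->; rewrite implybT.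
  by move=> ec; have := allrelP Xwc _ _ we ec; rewrite /lands_on ec.
- rewrite all_cat; apply/andP; split; last by apply/allP => e /(allP gw).
  apply/andP; split; apply/allP => e ee; rewrite ?(nac _ ee) ?ee /=.
    exact: (allP ga).
  by have /andP[_ lt] := bc _ ee.
- move=> e e' ee ee' lt; rewrite ltnS; apply: mono lt; rewrite mem_cat orbC in ee *.
    by move: ee; rewrite !mem_cat; case: (e \in a); case: (e \in w); case: (e \in c).
  by move: ee'; rewrite !mem_cat; case: (e' \in a); case: (e' \in w); case: (e' \in c).
- move=> m; rewrite count_cat.
  have -> : count (fun e => (if e \in c then (b e).+1 else 1) == m) a =
      if m == 1 then size a else 0.
    rewrite (eq_in_count (a2 := fun=> m == 1)); last by move=> e /nac->; rewrite eq_sym.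
    by case: (m == 1); rewrite ?count_predT ?count_pred0.
  have -> : count (fun e => (if e \in c then (b e).+1 else 1) == m) c =
      count (fun e => (b e).+1 == m) c.
    by apply: eq_in_count => e ->.
  case: m => [|m] /=; first by rewrite (eq_count (a2 := pred0)) ?count_pred0 //; case: (s).
  (* Time 1 belongs to [a] alone: push times in [c] were positive and are now at least 2. *)
  have [->|m0] := eqVneq m 0; last by rewrite eqSS (negbTE m0) add0n; exact: cb.
  rewrite (eq_in_count (a2 := pred0)) ?count_pred0 ?addn0 //.
  by move=> e /bc; case: (b e).
- move=> m; case: m => [|m]; last first.
    have := cg m; rewrite !count_cat [count _ c + _]addnCA addnA.
    by rewrite !(eq_count (a2 := fun e => g e == m)).
  by rewrite (eq_count (a2 := pred0)) ?count_pred0 //; case: (t).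
Qed.

Lemma schedule_pop s t inp a d b g : uniq (inp ++ a ++ d) -> cap_ok t (size a) ->
  pairwise ltn a -> {in inp ++ d & a, forall e e', e < e'} ->
  schedule b g s t inp d ->
  schedule (fun e => (b e).+1) (fun e => if e \in a then 1 else (g e).+1) s t inp (a ++ d).
Proof.
move=> u ca sa lta [[Pi Pd X /andP[/allP bi /allP gd]] [mono cb cg]].
have nia e : e \in inp -> (e \in a) = false.
  move=> ei; apply/negbTE; move: u; rewrite cat_uniq => /and3P[_ /hasPn n _].
  by apply/negP => ea; have := n e; rewrite mem_cat ea /= ei => /(_ isT).
have nda e : e \in d -> (e \in a) = false.
  move=> ed; apply/negbTE; move: u; rewrite catA cat_uniq => /and3P[_ /hasPn n _].
  by apply/negP => ea; have := n e ed; rewrite /= mem_cat ea orbT.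
have g0 e : e \in inp ++ d -> 0 < g e.
  by rewrite mem_cat => /orP[/bi/andP[]|/gd//]; exact: ltn_trans.
have na e : e \in inp ++ d -> (e \in a) = false.
  by rewrite mem_cat => /orP[/nia|/nda].
split; split.
- apply/(sub_in_pairwise (P := mem inp)): Pi; last by apply/allP.
  by move=> e e' ei ei'; rewrite /queued /lands_on /pops_above !nia // !ltnS !eqSS.
- rewrite pairwise_cat; apply/and3P; split.
  + apply/allrelP => e e' ea ed; rewrite /pops_above ea nda // ltnS.
    by rewrite g0 // mem_cat ed orbT.
  + apply/(sub_in_pairwise (P := mem a)): sa; last by apply/allP.
    by move=> e e' ea ea' lt; rewrite /pops_above !ea !ea' eqxx (lt : e < e') orbT.
  + apply/(sub_in_pairwise (P := mem d)): Pd; last by apply/allP.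
    by move=> e e' ed ed'; rewrite /pops_above !nda.
- rewrite allrel_catl; apply/andP; split; apply/allrelP => e e' ee ei; rewrite /lands_on.
    by rewrite ee.
  by have := allrelP X _ _ ee ei; rewrite /lands_on /pops_above nda // nia.
- apply/andP; split; apply/allP => e ee; last by case: (e \in a).
  by rewrite nia //; have /andP[_ lt] := bi _ ee.
- move=> e e' ee ee' lt.
  have [ea'|na'] := boolP (e' \in a); first by case: ifP.
  have id' x : x \in inp ++ a ++ d -> x \notin a -> x \in inp ++ d.
    by rewrite !mem_cat => + /negbTE nx; rewrite nx.
  have [ea|ea] := boolP (e \in a); last by apply: mono lt; exact: id'.
  by have := lta e' e (id' _ ee' na') ea; rewrite ltnNge (ltnW lt).
- move=> [|m]; last exact: cb.
  by rewrite (eq_count (a2 := pred0)) ?count_pred0 //; case: (s).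
- move=> m; rewrite catA count_cat count_cat addnAC -count_cat.
  rewrite (eq_in_count (s := inp ++ d) (a2 := fun e => (g e).+1 == m)); last by move=> e /na->.
  rewrite (eq_in_count (s := a) (a2 := fun=> m == 1)); last by move=> e ->; rewrite eq_sym.
  case: m => [|m] /=; first by rewrite !(eq_count (a2 := pred0)) ?count_pred0 //; case: (t).
  have [->|m0] := eqVneq m 0; last by rewrite eqSS (negbTE m0) count_pred0 addn0; exact: cg.
  rewrite count_predT (eq_in_count (a2 := pred0)) ?count_pred0 //.
  by move=> e /g0; case: (g e).
Qed.

(** The run is read backwards. Whatever is still to be popped ends up as the segment [r] of the
    sorted output, which supplies the order hypotheses of [schedule_pop]. *)
Lemma schedule_of_reach s t x y : fs_reach s t x y ->
  forall inp w out fin, x = (inp, w, out) -> y = ([::], [::], fin) -> sorted ltn fin ->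
  (exists2 r, fin = r ++ out & perm_eq r (inp ++ w)) /\
  exists b g, schedule b g s t inp w.
Proof.
elim=> {x y} [x inp w out fin -> [-> -> ->] _|].
  by split; [exists [::]|exists id, id; split; split=> // m; [case: (s)|case: (t)]].
move=> x y z step _ IH inp w out fin ex ez sfin.
case: step ex ez IH => [inp' w' out' k _ + ck [e1 e2 e3] ez IH|
                        inp' w' out' k _ + ck [e1 e2 e3] ez IH];
  rewrite {}e1 {}e2 {}e3 in IH * => k_le.
  have [[r efin pr] [b [g sch]]] := IH _ _ _ _ erefl ez sfin.
  have pr' : perm_eq r (inp ++ w).
    by rewrite (perm_trans pr) // perm_catCA catA cat_take_drop.
  split; first by exists r.
  have ur : uniq (inp ++ w).
    rewrite -(perm_uniq pr'); move: (sorted_uniq ltn_trans ltnn sfin).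
    by rewrite efin cat_uniq => /and3P[].
  have := @schedule_push s t (take k inp) (drop k inp) w b g.
  rewrite cat_take_drop => push; eexists; eexists; apply: push => //.
    by move: ur; rewrite cat_uniq => /and3P[].
  by rewrite size_takel.
have [[r efin pr] [b [g sch]]] := IH _ _ _ _ erefl ez sfin.
have pr' : perm_eq (r ++ take k w) (inp ++ w).
  rewrite (perm_trans (y := (inp ++ drop k w) ++ take k w)) ?perm_cat2r //.
  by rewrite -catA perm_cat2l perm_catC cat_take_drop.
split; first by exists (r ++ take k w); rewrite // -catA.
have ufin : pairwise ltn fin by rewrite -sorted_pairwise //; exact: ltn_trans.
have ur : uniq (inp ++ w).
  rewrite -(perm_uniq pr'); move: (sorted_uniq ltn_trans ltnn sfin).
  by rewrite efin catA cat_uniq => /and3P[].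
move: ufin; rewrite efin pairwise_cat => /and3P[/allrelP lt_r _].
rewrite pairwise_cat => /and3P[_ stk _].
have := @schedule_pop s t inp (take k w) (drop k w) b g.
rewrite cat_take_drop => pop; eexists; eexists; apply: pop => //.
  by rewrite size_takel.
move=> e e' ee ee'; apply: lt_r; first by rewrite (perm_mem pr).
by rewrite mem_cat ee'.
Qed.

Lemma card_ord_count (P : pred nat) (pi : seq nat) :
  #|[set i : 'I_(size pi) | P (nth 0 pi i)]| = count P pi.
Proof.
rewrite cardsE cardE /enum_mem size_filter -enumT.
have e : map (nth 0 pi) (map val (enum 'I_(size pi))) = pi.
  by rewrite val_enum_ord map_nth_iota0 ?take_size.
by rewrite -[in RHS]e !count_map.
Qed.

Definition ord_value (pi : seq nat) (i : 'I_(size pi)) := nth 0 pi i.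

Lemma ord_value_inj pi : uniq pi -> injective (@ord_value pi).
Proof. by move=> u i j /eqP; rewrite nth_uniq // => /eqP/val_inj. Qed.

Lemma certificate_of_sortable s t pi : is_perm pi -> sortable s t pi ->
  exists b g, certificate (@nat_of_ord (size pi)) (@ord_value pi) s t setT b g.
Proof.
move=> ppi /schedule_of_reach/(_ _ _ _ _ erefl erefl (iota_ltn_sorted _ _))[_].
move=> [b [g [[Q _ _ /andP[/allP bg _]] [mono cb cg]]]].
rewrite cats0 in mono cg.
have memp (i : 'I_(size pi)) : ord_value i \in pi by rewrite mem_nth.
have Qij (i j : 'I_(size pi)) : i < j -> queued b g (ord_value i) (ord_value j).
  by move=> ij; apply: (pairwiseP 0 Q); rewrite ?inE.
exists (fun i j => b (ord_value i) == b (ord_value j)),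
       (fun i j => g (ord_value i) == g (ord_value j)); split.
- split=> [x _|x y _ _|x y z _ _ _|x y z _ _ _]; rewrite ?eqxx //.
  + by rewrite eq_sym.
  + by move=> /eqP-> /eqP->.
  + move=> /Qij/andP[xy _] /Qij/andP[yz _] /eqP e.
    by rewrite eqn_leq xy /= e.
- split=> [x _|x y _ _|x y z _ _ _|x y z _ _ _]; rewrite ?eqxx //.
  + by rewrite eq_sym.
  + by move=> /eqP-> /eqP->.
  + move=> /(mono _ _ (memp x) (memp y)) xy /(mono _ _ (memp y) (memp z)) yz /eqP e.
    by rewrite eqn_leq xy andbT e.
- move=> x _; have := cb (b (ord_value x)); rewrite -card_ord_count.
  apply: cap_ok_leq; apply: subset_leq_card; apply/subsetP => y.
  by rewrite !inE eq_sym.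
- move=> x _; have := cg (g (ord_value x)); rewrite -card_ord_count.
  apply: cap_ok_leq; apply: subset_leq_card; apply/subsetP => y.
  by rewrite !inE eq_sym.
move=> i j _ _ ij; have := Qij i j ij; rewrite /queued /lands_on pops_aboveE => /andP[bij].
have /andP[_ bgj] := bg _ (memp j).
have [lt|ge] := ltnP (ord_value i) (ord_value j).
  have := mono _ _ (memp i) (memp j) lt; move: bij bgj lt; clear.
  move: (ord_value i) (ord_value j) => x y; case: eqP; rewrite /pops_above; lia.
have nij : i != j by apply/eqP => e; rewrite e ltnn in ij.
have lt : ord_value j < ord_value i.
  have up : uniq pi by rewrite (perm_uniq ppi) iota_uniq.
  rewrite ltn_neqAle ge andbT; apply: contra nij => /eqP/(ord_value_inj up)->.
  exact: eqxx.
have gij := mono _ _ (memp j) (memp i) lt.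
case: eqP => [eb|nb] H; split.
- apply/negP => /andP[_ /eqP eg]; by move: H; rewrite ?pops_aboveE eg ltnn eqxx.
- by [].
- by [].
(* Here [i] leaves no later than [j] is pushed. A violating [k] would be pushed no earlier than [j]
   and popped no later than [i], hence popped no later than it is pushed. *)
move=> _ ng k _; have /andP[_ bgk] := bg _ (memp k).
have nij' : b (ord_value j) >= g (ord_value i).
  move: H ng gij lt; clear; move: (ord_value i) (ord_value j) => x y.
  by rewrite ?pops_aboveE; lia.
apply/negP => /andP[Hb Hg].
have bjk : b (ord_value j) <= b (ord_value k).
  by case/orP: Hb => [/Qij/andP[]//|/eqP->].
have gik : g (ord_value k) <= g (ord_value i).
  by case/orP: Hg => [lt'|/eqP->//]; exact: mono lt'.
move: nij' bjk gik bgk; clear; lia.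
Qed.

(** * From certificates to sorting runs *)

Lemma filter_prefix (T : eqType) (P : pred T) (l : seq T) :
  pairwise (fun x y => P y ==> P x) l -> l = filter P l ++ filter (predC P) l.
Proof.
elim: l => //= x l IH /andP[/allP Px /IH e].
case: (boolP (P x)) => [px|npx] /=; first by rewrite -e.
have P0 y : y \in l -> ~~ P y by move=> /Px /implyP n; apply: contra npx.
have -> : filter P l = [::].
  by apply/eqP; rewrite -[_ == _]negbK -has_filter; apply/hasPn.
by rewrite cat0s; congr cons; apply/esym/all_filterP/allP.
Qed.

Lemma index_take_drop (pi : seq nat) k x y : uniq pi ->
  x \in take k pi -> y \in drop k pi -> index x pi < index y pi.
Proof.
move=> u xt yd; rewrite -(cat_take_drop k pi) !index_cat xt.
have -> : (y \in take k pi) = false.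
  move: u; rewrite -{1}(cat_take_drop k pi) cat_uniq => /and3P[_ /hasPn n _].
  by apply/negbTE/n.
by apply: ltn_addr; rewrite index_mem.
Qed.

Lemma pairwise_index (pi : seq nat) : uniq pi ->
  pairwise (fun x y => index x pi < index y pi) pi.
Proof.
move=> u; apply/(pairwiseP 0) => i j; rewrite !inE => li lj ij.
by rewrite !index_uniq.
Qed.

(* The strategy: pop the block of the largest remaining value as soon as all of
   it is on the working stack, and push the next block otherwise. *)
Section Simulation.
Variables (s t : capacity) (pi : seq nat) (b g : rel nat).
Hypothesis ppi : is_perm pi.
Local Notation n := (size pi).
Local Notation pos x := (index x pi).

Hypothesis b_refl : {in pi, forall x, b x x}.
Hypothesis b_sym : {in pi &, forall x y, b x y -> b y x}.
Hypothesis b_trans : {in pi & &, forall x y z, b x y -> b y z -> b x z}.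
Hypothesis b_conv : {in pi & &, forall x y z,
  pos x < pos y -> pos y < pos z -> b x z -> b x y}.
Hypothesis b_size : {in pi, forall x, cap_ok s (count (b x) pi)}.
Hypothesis g_refl : {in pi, forall x, g x x}.
Hypothesis g_sym : {in pi &, forall x y, g x y -> g y x}.
Hypothesis g_trans : {in pi & &, forall x y z, g x y -> g y z -> g x z}.
Hypothesis g_conv : {in pi & &, forall x y z, x < y -> y < z -> g x z -> g x y}.
Hypothesis g_size : {in pi, forall x, cap_ok t (count (g x) pi)}.
Hypothesis bg : {in pi &, forall x y, pos x < pos y ->
  if x < y then b x y = g x y
  else ~~ (b x y && g x y) /\
    (~~ b x y -> ~~ g x y -> {in pi, forall z,
       ~~ (((pos y < pos z) || b y z) && ((x < z) || g x z))})}.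

Lemma upi : uniq pi.
Proof. by rewrite (perm_uniq ppi) iota_uniq. Qed.

Lemma mem_pi x : (x \in pi) = (0 < x <= n).
Proof. by rewrite (perm_mem ppi) mem_iota add1n. Qed.

(** For [x] above [y] on the working stack: since larger values leave first, a smaller [x] has to
    leave together with [y], and a larger one in an earlier block. *)
Definition legal : rel nat := fun x y => (x < y) == g x y.

(** [k] elements have been pushed and the values above [m] popped; no push block straddles [k] and
    no pop block straddles [m]. *)
Definition invariant k m w := 
  [/\ k <= n, m <= n, perm_eq (drop k pi ++ w) (iota 1 m),
      {in take k pi & drop k pi, forall x y, ~~ b x y} &
      {in pi &, forall x y, x <= m < y -> ~~ g x y}] /\ pairwise legal w.

(** The waiting [z] is the third point in the last clause of [bg]: it comes with or after the block
    of [x], and is above [y] or in its pop block. So an [x] landing on a larger [y] from another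
    push block shares the pop block of [y]. *)
Lemma push_block k m w z : invariant k m w -> z \in drop k pi -> g m z -> m \in pi ->
  exists l, [/\ 0 < l, l <= size (drop k pi), cap_ok s l &
    invariant (k + l) m (take l (drop k pi) ++ w)].
Proof.
move=> [[kn mn pm Hb Hg] lw] zd gz mpi.
have dsub x : x \in drop k pi -> x \in pi by exact: mem_drop.
have udw : uniq (drop k pi ++ w) by rewrite (perm_uniq pm) iota_uniq.
have mem_w y : y \in w -> [/\ y \in take k pi, y \in pi & y <= m].
  move=> yw; have : y \in iota 1 m by rewrite -(perm_mem pm) mem_cat yw orbT.
  rewrite mem_iota add1n ltnS => /andP[y0 ym].
  have ypi : y \in pi by rewrite mem_pi y0 (leq_trans ym).
  split=> //; move: ypi; rewrite -{1}(cat_take_drop k pi) mem_cat => /orP[//|yd].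
  move: udw; rewrite cat_uniq => /and3P[_ /hasPn nd _].
  by have := nd y yw; rewrite /= yd.
case ed : (drop k pi) (zd) => [//|x0 rest] _.
have x0d : x0 \in drop k pi by rewrite ed mem_head.
have x0pi := dsub _ x0d.
rewrite -ed; pose a := filter (b x0) (drop k pi).
have pidx : pairwise (fun x y => pos x < pos y) (drop k pi).
  move: (pairwise_index upi).
  by rewrite -[X in pairwise _ X](cat_take_drop k pi) pairwise_cat => /and3P[].
have split_d : drop k pi = a ++ filter (predC (b x0)) (drop k pi).
  apply: filter_prefix; apply: (sub_in_pairwise (P := mem (drop k pi))) (pidx); last by apply/allP.
  move=> x y xd yd xy; apply/implyP => b0y.
  have [->|nx] := eqVneq x x0; first exact: b_refl.
  apply: (b_conv x0pi (dsub _ xd) (dsub _ yd)) => //.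
  move: xd; rewrite ed inE (negbTE nx) /= => xr.
  by move: pidx; rewrite ed /= => /andP[/allP/(_ _ xr)].
have ta : take (size a) (drop k pi) = a by rewrite split_d take_size_cat.
have da : drop (size a) (drop k pi) = filter (predC (b x0)) (drop k pi).
  by rewrite {1}split_d drop_size_cat.
exists (size a); rewrite ta; split.
- by rewrite size_filter -has_count; apply/hasP; exists x0; rewrite ?b_refl.
- by rewrite size_filter count_size.
- rewrite size_filter; apply: cap_ok_leq (b_size x0pi).
  by rewrite -{2}(cat_take_drop k pi) count_cat leq_addl.
have tka : take (k + size a) pi = take k pi ++ a by rewrite takeD ta.
have dka : drop (k + size a) pi = filter (predC (b x0)) (drop k pi).
  by rewrite addnC -drop_drop da.
have mem_a x : x \in a -> [/\ x \in drop k pi, x \in pi & b x0 x].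
  by rewrite mem_filter => /andP[bx xd]; split=> //; exact: dsub.
split.
  split=> //.
  - rewrite -(subnKC kn) leq_add2l -size_drop size_filter; exact: count_size.
  - by rewrite dka perm_catCA catA -split_d.
  - move=> x y; rewrite tka dka mem_cat [y \in _]mem_filter => xx /andP[/= nb yd].
    case/orP: xx => [xt|/mem_a[xd xpi bx]]; first exact: Hb.
    by apply: contra nb => bxy; apply: (b_trans x0pi xpi (dsub _ yd)).
rewrite pairwise_cat lw andbT; apply/andP; split.
  apply/allrelP => x y xa yw; have [xd xpi bx] := mem_a x xa.
  have [yt ypi ym] := mem_w y yw.
  have pyx := index_take_drop upi yt xd; have nbyx := Hb _ _ yt xd.
  have := bg ypi xpi pyx; rewrite /legal.
  have [yx|xy] := ltnP y x.
    rewrite (negbTE nbyx) ltnNge (ltnW yx) /= => gyx; apply/eqP/esym/negbTE.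
    by apply/negP => /(g_sym xpi ypi); rewrite -gyx.
  have nxy : x != y by apply/eqP => e; rewrite e ltnn in pyx.
  rewrite ltn_neqAle nxy xy => -[_ H]; apply/eqP/esym.
  apply: contraT => ngxy; have ngyx : ~~ g y x by apply: contra ngxy; exact: g_sym.
  have zpi := dsub _ zd; have := H nbyx ngyx z zpi; case/negP.
  apply/andP; split.
    move: zd; rewrite split_d mem_cat => /orP[za|zf].
      have [_ _ bz] := mem_a z za.
      by rewrite (b_trans xpi x0pi zpi) ?orbT //; exact: b_sym.
    by rewrite (index_take_drop upi (k := k + size a)) // ?tka ?dka // mem_cat xa orbT.
  have [//|zy] := ltnP y z; apply/orP; right.
  have [->|nzy] := eqVneq y z; first exact: g_refl.
  apply: (g_sym zpi ypi); have [<-|nym] := eqVneq m y.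
    exact: g_sym.
  apply: (g_conv zpi ypi mpi); last exact: g_sym.
    by rewrite ltn_neqAle eq_sym nzy.
  by rewrite ltn_neqAle eq_sym nym.
have pa : pairwise (fun x y => pos x < pos y) a by exact: pairwise_filter.
apply: (sub_in_pairwise (P := mem a)) pa; last by apply/allP.
move=> x y /mem_a[xd xpi bx] /mem_a[yd ypi b_y] /(bg xpi ypi); rewrite /legal.
have bxy : b x y by apply: (b_trans xpi x0pi ypi) => //; exact: b_sym.
by rewrite bxy /=; case: (x < y) => [<-|[/negbTE->]].
Qed.

(** With the block of [m] wholly on the working stack, legality makes it an increasing prefix; by
    convexity its values form an interval ending at [m], so the output remains an interval. *)
Lemma pop_block k m w : invariant k m w -> {in drop k pi, forall z, ~~ g m z} -> m \in pi ->
  exists l m', [/\ 0 < l, l <= size w, cap_ok t l, m' < m &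
    invariant k m' (drop l w) /\
    take l w ++ iota m.+1 (n - m) = iota m'.+1 (n - m')].
Proof.
move=> [[kn mn pm Hb Hg] lw] nz mpi.
have udw : uniq (drop k pi ++ w) by rewrite (perm_uniq pm) iota_uniq.
have mem_dw x : (x \in drop k pi ++ w) = (0 < x <= m) by rewrite (perm_mem pm) mem_iota add1n.
have mem_w y : y \in w -> y \in pi /\ 0 < y <= m.
  move=> yw; have : y \in drop k pi ++ w by rewrite mem_cat yw orbT.
  by rewrite mem_dw => /andP[y0 ym]; rewrite mem_pi y0 ym (leq_trans ym).
pose a := filter (g m) w; pose c := filter (predC (g m)) w.
have m0 : 0 < m by move: mpi; rewrite mem_pi => /andP[].
have mem_a x : (x \in a) = [&& 0 < x, x <= m & g m x].
  rewrite mem_filter; apply/andP/and3P => [[gx /mem_w[_ /andP[]]]//|[x0 xm gx]].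
  split=> //; have : x \in drop k pi ++ w by rewrite mem_dw x0.
  by rewrite mem_cat => /orP[/nz|//]; rewrite gx.
have ma : m \in a by rewrite mem_a m0 leqnn g_refl.
have split_w : w = a ++ c.
  apply: filter_prefix; apply: (sub_in_pairwise (P := mem w)) (lw); last by apply/allP.
  move=> x y /mem_w[xpi /andP[_ xm]] /mem_w[ypi /andP[_ ym]]; rewrite /legal => leg.
  apply/implyP => gy; have [<-|nmx] := eqVneq m x; first exact: g_refl.
  have xm' : x < m by rewrite ltn_neqAle eq_sym nmx.
  have [xy|yx] := ltnP x y.
    move: leg; rewrite xy => /eqP/esym gxy.
    by apply: (g_trans mpi ypi xpi) => //; exact: g_sym.
  have [<-//|nyx] := eqVneq y x; apply: (g_trans mpi ypi xpi) => //.
  apply: (g_conv ypi xpi mpi) => //; last exact: g_sym.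
  by rewrite ltn_neqAle nyx.
have sa : sorted ltn a.
  rewrite sorted_pairwise; last exact: ltn_trans.
  have : pairwise legal a by exact: pairwise_filter.
  apply: (sub_in_pairwise (P := mem a)); last by apply/allP.
  move=> x y; rewrite !mem_filter => /andP[gx /mem_w[xpi _]] /andP[gy /mem_w[ypi _]].
  rewrite /legal; have -> : g x y by apply: (g_trans xpi mpi ypi) => //; exact: g_sym.
  by move/eqP.
have [h [h0 hm ea]] : exists h, [/\ 0 < h, h <= m & a = iota h (m.+1 - h)].
  case ea : a (ma) => [//|h a'] _.
  have := mem_head h a'; rewrite -ea mem_a => /and3P[h0 hm gh].
  exists h; split=> //; apply: (irr_sorted_eq ltn_trans ltnn) => //.
    exact: iota_ltn_sorted.
  have hpi : h \in pi by rewrite mem_pi h0 (leq_trans hm).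
  move=> x; rewrite mem_iota (subnKC (leqW hm)) ltnS.
  apply/idP/andP => [xa|[hx xm]].
    move: (xa); rewrite mem_a => /and3P[_ -> _]; split=> //.
    move: xa sa; rewrite ea inE => /predU1P[->//|xa'] /=.
    by rewrite path_sortedE; [case/andP=> /allP/(_ _ xa')/ltnW|exact: ltn_trans].
  have xpi : x \in pi by rewrite mem_pi (leq_trans h0) ?(leq_trans xm).
  rewrite mem_a xm (leq_trans h0) //=.
  have [->|nx] := eqVneq x h; first by [].
  have [->|nxm] := eqVneq x m; first exact: g_refl.
  apply: (g_trans mpi hpi xpi) => //; apply: (g_conv hpi xpi mpi); last exact: g_sym.
    by rewrite ltn_neqAle eq_sym nx.
  by rewrite ltn_neqAle nxm.
have size_a : size a = m.+1 - h by rewrite ea size_iota.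
have ta : take (size a) w = a by rewrite split_w take_size_cat.
have da : drop (size a) w = c by rewrite {1}split_w drop_size_cat.
exists (size a), h.-1; rewrite ta da; split.
- by rewrite size_a subn_gt0 ltnS.
- by rewrite split_w size_cat leq_addr.
- apply: cap_ok_leq (g_size mpi); rewrite -size_filter; apply: uniq_leq_size.
    by rewrite ea iota_uniq.
  by move=> x; rewrite !mem_filter => /andP[-> /mem_w[->]].
- by rewrite prednK.
split; last first.
  have -> : n - h.-1 = (m.+1 - h) + (n - m) by move: h0 hm mn; clear; lia.
  by rewrite ea prednK // iotaD (subnKC (leqW hm)).
split; last by apply: pairwise_filter.
split=> //.
- by rewrite (leq_trans _ mn) // (leq_trans _ hm) // leq_pred.
- rewrite -(perm_cat2r a) -catA (perm_trans (y := drop k pi ++ w)) //.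
    by rewrite perm_cat2l perm_catC -split_w.
  suff <- : iota 1 m = iota 1 h.-1 ++ a by [].
  have em : m = h.-1 + (m.+1 - h) by move: h0 hm; clear; lia.
  by rewrite {1}em iotaD add1n prednK // ea.
move=> x y xpi ypi /andP[xh hy].
have [ym|my] := leqP y m; last first.
  by apply: Hg; rewrite // my andbT (leq_trans xh) // (leq_trans _ hm) // leq_pred.
apply/negP => gxy.
have ya : y \in a by rewrite ea mem_iota (subnKC (leqW hm)) ltnS ym andbT -(prednK h0).
have xa : x \in a.
  move: ya; rewrite !mem_a => /and3P[_ _ gy].
  have xpi' := xpi; move: xpi; rewrite mem_pi => /andP[-> xn].
  rewrite (leq_trans xh) ?(leq_trans _ hm) ?leq_pred //=.
  by apply: (g_trans mpi ypi xpi') => //; exact: g_sym.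
move: xa; rewrite ea mem_iota => /andP[hx _].
by move: xh; rewrite leqNgt -ltnS prednK // ltnS hx.
Qed.

(** The measure counts the elements still to be pushed plus those still to be popped. *)
Lemma simulate N k m w : (n - k) + m <= N -> invariant k m w ->
  fs_reach s t (drop k pi, w, iota m.+1 (n - m)) ([::], [::], iota 1 n).
Proof.
elim: N k m w => [|N IH] k m w le inv; have [[kn mn pm _ _] _] := inv.
all: have [m0|m_gt0] := posnP m; first
  (move: pm; rewrite m0 => /perm_size/eqP;
   rewrite size_cat addn_eq0 !size_eq0 => /andP[/eqP-> /eqP->];
   rewrite subn0; exact: fs_refl).
  by move: le; rewrite leqn0 addn_eq0 => /andP[_ /eqP m0]; rewrite m0 in m_gt0.
have mpi : m \in pi by rewrite mem_pi m_gt0.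
have [/hasP[z zd gz]|/hasPn nz] := boolP (has (g m) (drop k pi)).
  have [l [l0 lsz cl inv']] := push_block inv zd gz mpi.
  apply: fs_trans (fs_push t w _ l0 lsz cl) _.
  rewrite drop_drop addnC; apply: IH inv'.
  move: lsz; rewrite size_drop; move: le l0; clear; lia.
have [l [m' [l0 lsz cl mm [inv' eo]]]] := pop_block inv nz mpi.
apply: fs_trans (fs_pop s _ _ l0 lsz cl) _.
rewrite eo; apply: IH inv'; move: le mm; clear; lia.
Qed.

Lemma sortable_simulation : sortable s t pi.
Proof.
have := @simulate _ 0 n [::] (leqnn _); rewrite drop0 subnn; apply; split=> //; split=> //.
- by rewrite drop0 cats0; exact: ppi.
- by rewrite take0.
move=> x y _; rewrite mem_pi => /andP[_ yn] /andP[_]; rewrite ltnNge yn //.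
Qed.

End Simulation.

(** * The basis is finite *)

Definition image_rel (T : finType) (S : eqType) (f : T -> S) (r : rel T) : rel S :=
  fun x y => [exists i, exists j, [&& f i == x, f j == y & r i j]].

Lemma image_relE (T : finType) (S : eqType) (f : T -> S) (r : rel T) i j :
  injective f -> image_rel f r (f i) (f j) = r i j.
Proof.
move=> injf; apply/existsP/idP => [[i' /existsP[j' /and3P[/eqP/injf-> /eqP/injf->]]]//|rij].
by exists i; apply/existsP; exists j; rewrite !eqxx.
Qed.

Section Transfer.
Variables (T T' : finType) (p q : T -> nat) (p' q' : T' -> nat) (f : T' -> T).
Hypothesis injf : injective f.
Hypothesis fp : forall a c, (p (f a) < p (f c)) = (p' a < p' c).
Hypothesis fq : forall a c, (q (f a) < q (f c)) = (q' a < q' c).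

Lemma conv_equiv_image (h : T -> nat) (h' : T' -> nat) r :
  (forall a c, (h (f a) < h (f c)) = (h' a < h' c)) ->
  conv_equiv h' setT r -> conv_equiv h (f @: setT) (image_rel f r).
Proof.
move=> fh [rr sr tr cr]; split.
- by move=> _ /imsetP[a _ ->]; rewrite image_relE // rr ?inE.
- by move=> _ _ /imsetP[a _ ->] /imsetP[c _ ->]; rewrite !image_relE //; apply: sr; rewrite inE.
- move=> _ _ _ /imsetP[a _ ->] /imsetP[c _ ->] /imsetP[d _ ->].
  by rewrite !image_relE //; apply: tr; rewrite inE.
- move=> _ _ _ /imsetP[a _ ->] /imsetP[c _ ->] /imsetP[d _ ->].
  by rewrite !image_relE // !fh; apply: cr; rewrite inE.
Qed.

Lemma classes_le_image c r : classes_le c setT r ->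
  classes_le c (f @: setT) (image_rel f r).
Proof.
move=> le _ /imsetP[a _ ->]; apply: cap_ok_leq (le a (in_setT a)).
apply: leq_trans (leq_imset_card f _); apply: subset_leq_card; apply/subsetP => y.
by rewrite inE => /andP[/imsetP[d _ ->]]; rewrite image_relE // => rad; rewrite imset_f // !inE.
Qed.

Lemma certificate_image s t b g : certificate p' q' s t setT b g ->
  certificate p q s t (f @: setT) (image_rel f b) (image_rel f g).
Proof.
move=> [cb cg lb lg C]; split; try exact: classes_le_image.
- exact: conv_equiv_image fp cb.
- exact: conv_equiv_image fq cg.
move=> _ _ /imsetP[a _ ->] /imsetP[c _ ->]; rewrite fp => ac.
have := C a c (in_setT a) (in_setT c) ac; rewrite !image_relE // fq.
case: (q' a < q' c) => // -[nbg H]; split=> // nb ng _ /imsetP[d _ ->].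
by rewrite !image_relE // fp fq; apply: H; rewrite ?inE.
Qed.

End Transfer.

Lemma sortable_of_certificate s t pi b g : is_perm pi ->
  certificate (@nat_of_ord (size pi)) (@ord_value pi) s t setT b g ->
  sortable s t pi.
Proof.
move=> ppi [[rb sb tb cb] [rg sg tg cg] lb lg C].
have u : uniq pi by rewrite (perm_uniq ppi) iota_uniq.
have injv := ord_value_inj u.
have val x : x \in pi -> exists2 i : 'I_(size pi), x = ord_value i & index x pi = i.
  move=> xpi; have lx : index x pi < size pi by rewrite index_mem.
  by exists (Ordinal lx); rewrite //= /ord_value nth_index.
have posE (i : 'I_(size pi)) : index (ord_value i) pi = i by rewrite index_uniq.
apply: (sortable_simulation (b := image_rel (@ord_value pi) b)
                            (g := image_rel (@ord_value pi) g) ppi).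
- by move=> _ /val[i -> _]; rewrite image_relE // rb ?inE.
- by move=> _ _ /val[i -> _] /val[j -> _]; rewrite !image_relE //; apply: sb; rewrite inE.
- move=> _ _ _ /val[i -> _] /val[j -> _] /val[k -> _].
  by rewrite !image_relE //; apply: tb; rewrite inE.
- move=> _ _ _ /val[i -> _] /val[j -> _] /val[k -> _].
  by rewrite !image_relE // !posE; apply: cb; rewrite inE.
- move=> _ /val[i -> _]; rewrite -card_ord_count.
  apply: cap_ok_leq (lb i (in_setT i)); apply: subset_leq_card; apply/subsetP => j.
  by rewrite !inE -[nth 0 pi j]/(ord_value j) image_relE.
- by move=> _ /val[i -> _]; rewrite image_relE // rg ?inE.
- by move=> _ _ /val[i -> _] /val[j -> _]; rewrite !image_relE //; apply: sg; rewrite inE.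
- move=> _ _ _ /val[i -> _] /val[j -> _] /val[k -> _].
  by rewrite !image_relE //; apply: tg; rewrite inE.
- move=> _ _ _ /val[i -> _] /val[j -> _] /val[k -> _].
  by rewrite !image_relE //; apply: cg; rewrite inE.
- move=> _ /val[i -> _]; rewrite -card_ord_count.
  apply: cap_ok_leq (lg i (in_setT i)); apply: subset_leq_card; apply/subsetP => j.
  by rewrite !inE -[nth 0 pi j]/(ord_value j) image_relE.
move=> _ _ /val[i -> _] /val[j -> _]; rewrite !posE => ij.
have := C i j (in_setT i) (in_setT j) ij; rewrite !image_relE //.
case: (ord_value i < ord_value j) => // -[nbg H]; split=> // nb ng _ /val[k -> _].
by rewrite posE !image_relE //; apply: H; rewrite ?inE.
Qed.

(** * Patterns carried by sets of positions *)

Definition standardize (l : seq nat) := [seq (count (fun y => y < x) l).+1 | x <- l].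

Lemma count_lt_mono (l : seq nat) x y : x \in l ->
  (count (fun z => z < x) l < count (fun z => z < y) l) = (x < y).
Proof.
have mono a c : a <= c -> count (fun z => z < a) l <= count (fun z => z < c) l.
  by move=> ac; apply: sub_count => z /= /leq_trans; apply.
move=> xl; have [xy|yx] := ltnP x y; last by rewrite ltnNge mono.
have x1 : 0 < count (pred1 x) l by rewrite -has_count has_pred1.
have disj : count (predI (fun z => z < x) (pred1 x)) l = 0.
  rewrite (eq_count (a2 := pred0)) ?count_pred0 // => z /=.
  by case: eqP => [->|]; rewrite ?ltnn ?andbF.
apply: (@leq_trans (count (predU (fun z => z < x) (pred1 x)) l)).
  have := count_predUI (fun z => z < x) (pred1 x) l; rewrite disj addn0 => ->.
  by rewrite -addn1 leq_add2l.
by apply: sub_count => z /= /orP[/ltn_trans|/eqP->//]; apply.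
Qed.

Lemma standardize_iso l : order_iso (standardize l) l.
Proof.
split=> [|i j]; rewrite size_map // => li lj.
by rewrite !(nth_map 0) // ltnS count_lt_mono ?mem_nth.
Qed.

Lemma standardize_perm l : uniq l -> is_perm (standardize l).
Proof.
move=> ul; have us : uniq (standardize l).
  rewrite map_inj_in_uniq // => x y xl yl [e].
  have := count_lt_mono y xl; have := count_lt_mono x yl; rewrite e ltnn.
  by case: (ltngtP x y).
apply: uniq_perm; rewrite ?iota_uniq //.
apply: (uniq_min_size us _ _).2; last by rewrite size_iota.
move=> _ /mapP[x xl ->]; rewrite mem_iota add1n ltnS size_map /=.
rewrite -(count_predC (fun y => y < x) l) -addn1 leq_add2l -has_count.
by apply/hasP; exists x; rewrite //= ltnn.
Qed.

Section Subsequences.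
Variable (pi : seq nat).
Local Notation n := (size pi).

Definition subperm (W : {set 'I_n}) := standardize [seq ord_value i | i <- enum W].

Lemma size_subperm W : size (subperm W) = #|W|.
Proof. by rewrite !size_map -cardE. Qed.

Lemma subperm_involved W : involved (subperm W) pi.
Proof.
exists [seq ord_value i | i <- enum W]; split; last exact: standardize_iso.
have e : [seq ord_value i | i <- enum 'I_n] = pi.
  rewrite (eq_map (g := nth 0 pi \o val)) // map_comp val_enum_ord.
  by rewrite map_nth_iota0 ?take_size.
rewrite -[X in subseq _ X]e; apply: map_subseq.
by rewrite /enum_mem [X in subseq _ X](eq_filter (a2 := predT)) // filter_predT filter_subseq.
Qed.

Lemma subperm_perm W : uniq pi -> is_perm (subperm W).
Proof.
move=> u; apply: standardize_perm; rewrite map_inj_uniq ?enum_uniq //.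
exact: ord_value_inj.
Qed.

Definition subperm_pos W (a : 'I_(size (subperm W))) : 'I_n :=
  enum_val (cast_ord (size_subperm W) a).

Lemma subperm_pos_inj W : injective (@subperm_pos W).
Proof. by move=> a c /enum_val_inj/cast_ord_inj. Qed.

Lemma subperm_pos_image W : @subperm_pos W @: setT = W.
Proof.
apply/setP => i; apply/imsetP/idP => [[a _ ->]|iW]; first exact: enum_valP.
exists (cast_ord (esym (size_subperm W)) (enum_rank_in iW i)) => //.
by rewrite /subperm_pos cast_ordKV enum_rankK_in.
Qed.

Lemma subperm_pos_lt W (a c : 'I_(size (subperm W))) :
  (subperm_pos a < subperm_pos c) = (a < c).
Proof.
have lt (a' c' : 'I_(size (subperm W))) : a' < c' -> subperm_pos a' < subperm_pos c'.
  move=> ac; rewrite /subperm_pos !(enum_val_nth (subperm_pos a')) /=.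
  have so : sorted (relpre val ltn) (enum W).
    rewrite /enum_mem; apply: sorted_filter; first by move=> x y z; exact: ltn_trans.
    by rewrite -enumT -sorted_map val_enum_ord iota_ltn_sorted.
  apply: (sorted_ltn_nth _ _ so) => //; first by move=> x y z; exact: ltn_trans.
    by rewrite inE -cardE -(size_subperm W).
  by rewrite inE -cardE -(size_subperm W).
apply/idP/idP; last exact: lt.
have [//|/lt ca|/val_inj->] := ltngtP a c; last by rewrite ltnn.
by rewrite ltnNge (ltnW ca).
Qed.

Lemma subperm_value_lt W (a c : 'I_(size (subperm W))) :
  (ord_value (subperm_pos a) < ord_value (subperm_pos c)) =
  (@ord_value (subperm W) a < @ord_value (subperm W) c).
Proof.
have [e H] := standardize_iso [seq ord_value i | i <- enum W].
rewrite [RHS]H ?ltn_ord // !(nth_map (subperm_pos a)) -?cardE -?(size_subperm W) //.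
have nthE c' : nth (subperm_pos a) (enum W) (c' : 'I_(size (subperm W))) = subperm_pos c'.
  by rewrite [RHS](enum_val_nth (subperm_pos a)).
by rewrite !nthE.
Qed.

End Subsequences.

Definition basis_bound s t := local_bound s t + 7 * local_bound s t ^ 2.

(** In a longer minimal permutation every set of at most [basis_bound] points carries a proper
    pattern, which is sortable and so certified. The resulting local certificates glue to a global
    one, and the permutation would be sortable. *)
Lemma size_minimal_unsortable s t pi : cap_valid s -> cap_valid t ->
  inU s t pi -> size pi <= basis_bound s t.
Proof.
move=> vs vt [ppi [nsort min]]; rewrite leqNgt; apply/negP => big; apply: nsort.
have u : uniq pi by rewrite (perm_uniq ppi) iota_uniq.
have injv := ord_value_inj u.
have certW (W : {set 'I_(size pi)}) : #|W| <= basis_bound s t ->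
    exists b g, certificate (@nat_of_ord _) (@ord_value pi) s t W b g.
  move=> cW; have pW := subperm_perm W u.
  have [|b [g cert]] := @certificate_of_sortable s t (subperm W) pW.
    apply: min => //; first exact: subperm_involved.
    by move=> e; move: big; rewrite -e size_subperm ltnNge cW.
  exists (image_rel (@subperm_pos pi W) b), (image_rel (@subperm_pos pi W) g).
  rewrite -{1}(subperm_pos_image W); apply: (certificate_image (@subperm_pos_inj pi W)) cert.
    exact: subperm_pos_lt.
  exact: subperm_value_lt.
have LC : locally_certified (@nat_of_ord _) (@ord_value pi) s t.
  move=> A cA; apply: (local_certificate_of (@ord_inj _) injv certW).
  by rewrite /basis_bound leq_add // leq_mul2l leq_exp2r.
have [b [g cert]] := certificate_of_local (@ord_inj _) injv vs vt LC.
exact: sortable_of_certificate cert.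
Qed.

Theorem mainTheorem2 (s t : capacity) :
  cap_valid s -> cap_valid t ->
  exists U : seq (seq nat), forall sigma, inU s t sigma -> sigma \in U.
Proof.
move=> vs vt; pose N := basis_bound s t.
exists (flatten [seq permutations (iota 1 n) | n <- iota 0 N.+1]) => sigma inUs.
have sz := size_minimal_unsortable vs vt inUs; have [ps _] := inUs.
apply/flatten_mapP; exists (size sigma); first by rewrite mem_iota.
by rewrite mem_permutations.
Qed.
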